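(* (Cauchy-type theorem) Let $\mathcal C$ be a perfect integral modular fusion category (over $\mathbb C$), with simple objects $X_1,\dots,X_m$ up to isomorphism and $d_i=\mathrm{FPdim}(X_i)$. Then $$\mathcal V(\mathcal C)=\bigcup_{i=1}^m\mathcal V(d_i);$$ thus, for every prime $p$ dividing $\mathrm{FPdim}(\mathcal C)$ there is a simple object $X$ of $\mathcal C$ such that $p$ divides $\mathrm{FPdim}(X)$. Consequently, $p^2$ divides $\mathrm{FPdim}(\mathcal C)$ for every such $p$.
   Context: $\mathrm{FPdim}$ is the Frobenius–Perron dimension. Integral: $\mathrm{FPdim}(X)\in\mathbb Z$ for all simple $X$. Perfect: the only invertible simple object (equivalently, the only simple object of Frobenius–Perron dimension $1$) is the unit object, up to isomorphism. For a non-negative integer $n$, $\mathcal V(n)$ denotes the set of prime divisors of $n$, and $\mathcal V(\mathcal C):=\mathcal V(\mathrm{FPdim}(\mathcal C))$. *)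

(* Defs.v *)
(* Conventions follow Etingof-Gelaki-Nikshych-Ostrik, "Tensor Categories". *)
From mathcomp Require Import all_boot all_order all_algebra.
From mathcomp Require Import classical_sets reals.
From mathcomp.real_closed Require Export complex.

Set Implicit Arguments.
Unset Strict Implicit.
Unset Printing Implicit Defensive.

Import GRing.Theory Num.Theory.
Local Open Scope ring_scope.

Declare Scope cat_scope.
Delimit Scope cat_scope with cat.
Local Open Scope cat_scope.

Reserved Notation "g ∘ f" (at level 40, left associativity).
Reserved Notation "X ⊗ Y" (at level 38, left associativity).
Reserved Notation "f ⊗₁ g" (at level 38, left associativity).

(* Categories enriched in finite-dimensional K-vector spaces: the Hom-spaces
   are [vectType]s, so Hom-finiteness is built in. *)
Record linCategory (K : closedFieldType) := LinCategory {
  obj :> Type;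
  hom : obj -> obj -> vectType K;
  idm : forall X, hom X X;
  comp : forall X Y Z, hom Y Z -> hom X Y -> hom X Z;
  comp1m : forall X Y (f : hom X Y), comp (idm Y) f = f;
  compm1 : forall X Y (f : hom X Y), comp f (idm X) = f;
  compmA : forall W X Y Z (h : hom Y Z) (g : hom X Y) (f : hom W X),
    comp h (comp g f) = comp (comp h g) f;
  comp_linear_l : forall X Y Z (a : K) (g g' : hom Y Z) (f : hom X Y),
    comp (a *: g + g') f = a *: comp g f + comp g' f;
  comp_linear_r : forall X Y Z (a : K) (g : hom Y Z) (f f' : hom X Y),
    comp g (a *: f + f') = a *: comp g f + comp g f'
}.
Arguments hom {K l} X Y.
Arguments idm {K l} X.
Arguments comp {K l X Y Z} g f.

Notation "g ∘ f" := (comp g f) : cat_scope.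

Section LinearCategories.
Variables (K : closedFieldType) (C : linCategory K).
Implicit Types X Y Z : C.

Definition is_iso X Y (f : hom X Y) : Prop :=
  exists g : hom Y X, g ∘ f = idm X /\ f ∘ g = idm Y.

Definition isomorphic X Y : Prop := exists f : hom X Y, is_iso f.

Definition is_mono X Y (f : hom X Y) : Prop :=
  forall Z (g h : hom Z X), f ∘ g = f ∘ h -> g = h.

Definition is_epi X Y (f : hom X Y) : Prop :=
  forall Z (g h : hom Y Z), g ∘ f = h ∘ f -> g = h.

Definition is_zero X : Prop :=
  forall Y, (forall f : hom X Y, f = 0) /\ (forall f : hom Y X, f = 0).

Definition is_kernel X Y Z (f : hom X Y) (k : hom Z X) : Prop :=
  f ∘ k = 0 /\
  forall T (g : hom T X), f ∘ g = 0 -> exists! h : hom T Z, k ∘ h = g.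

Definition is_cokernel X Y Z (f : hom X Y) (q : hom Y Z) : Prop :=
  q ∘ f = 0 /\
  forall T (g : hom Y T), g ∘ f = 0 -> exists! h : hom Z T, h ∘ q = g.

(* [P] is the direct sum (biproduct) of the finite family [F]; the empty
   direct sums are the zero objects. *)
Definition is_direct_sum n (F : 'I_n -> C) (P : C) : Prop :=
  exists (inj : forall i, hom (F i) P) (proj : forall i, hom P (F i)),
    [/\ forall i, proj i ∘ inj i = idm (F i),
        forall i j, i != j -> proj j ∘ inj i = 0
      & \sum_(i < n) (inj i ∘ proj i) = idm P].

Definition is_abelian : Prop :=
  [/\ forall n (F : 'I_n -> C), exists P, is_direct_sum F P,
      forall X Y (f : hom X Y), exists Z (k : hom Z X), is_kernel f k,
      forall X Y (f : hom X Y), exists Z (q : hom Y Z), is_cokernel f q,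
      forall X Y (f : hom X Y), is_mono f ->
        exists Z (g : hom Y Z), is_kernel g f
    & forall X Y (f : hom X Y), is_epi f ->
        exists Z (g : hom Z X), is_cokernel g f].

Definition is_simple X : Prop :=
  ~ is_zero X /\
  forall Y (f : hom Y X), is_mono f -> is_zero Y \/ is_iso f.

Definition is_semisimple : Prop :=
  forall X, exists n (F : 'I_n -> C),
    (forall i, is_simple (F i)) /\ is_direct_sum F X.

End LinearCategories.

Record tensorData (K : closedFieldType) (C : linCategory K) := TensorData {
  tens : C -> C -> C;
  tensm : forall X Y X' Y' : C,
    hom X Y -> hom X' Y' -> hom (tens X X') (tens Y Y');
  unit_obj : C;
  assoc : forall X Y Z : C, hom (tens (tens X Y) Z) (tens X (tens Y Z));
  assocV : forall X Y Z : C, hom (tens X (tens Y Z)) (tens (tens X Y) Z);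
  lunit : forall X : C, hom (tens unit_obj X) X;
  lunitV : forall X : C, hom X (tens unit_obj X);
  runit : forall X : C, hom (tens X unit_obj) X;
  runitV : forall X : C, hom X (tens X unit_obj)
}.

Record is_monoidal (K : closedFieldType) (C : linCategory K)
    (T : tensorData C) : Prop := IsMonoidal {
  tensm_id : forall X Y : C, tensm T (idm X) (idm Y) = idm (tens T X Y);
  tensm_comp : forall (X Y Z X' Y' Z' : C) (g : hom Y Z) (f : hom X Y)
      (g' : hom Y' Z') (f' : hom X' Y'),
    tensm T (g ∘ f) (g' ∘ f') = tensm T g g' ∘ tensm T f f';
  tensm_linear_l : forall (X Y X' Y' : C) (a : K) (f g : hom X Y)
      (h : hom X' Y'),
    tensm T (a *: f + g) h = a *: tensm T f h + tensm T g h;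
  tensm_linear_r : forall (X Y X' Y' : C) (a : K) (h : hom X Y)
      (f g : hom X' Y'),
    tensm T h (a *: f + g) = a *: tensm T h f + tensm T h g;
  assocK : forall X Y Z : C, assocV T X Y Z ∘ assoc T X Y Z = idm _;
  assocVK : forall X Y Z : C, assoc T X Y Z ∘ assocV T X Y Z = idm _;
  lunitK : forall X : C, lunitV T X ∘ lunit T X = idm _;
  lunitVK : forall X : C, lunit T X ∘ lunitV T X = idm _;
  runitK : forall X : C, runitV T X ∘ runit T X = idm _;
  runitVK : forall X : C, runit T X ∘ runitV T X = idm _;
  assoc_natural : forall (X Y Z X' Y' Z' : C)
      (f : hom X X') (g : hom Y Y') (h : hom Z Z'),
    assoc T X' Y' Z' ∘ tensm T (tensm T f g) h =
    tensm T f (tensm T g h) ∘ assoc T X Y Z;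
  lunit_natural : forall (X Y : C) (f : hom X Y),
    lunit T Y ∘ tensm T (idm (unit_obj T)) f = f ∘ lunit T X;
  runit_natural : forall (X Y : C) (f : hom X Y),
    runit T Y ∘ tensm T f (idm (unit_obj T)) = f ∘ runit T X;
  pentagon : forall W X Y Z : C,
    assoc T W X (tens T Y Z) ∘ assoc T (tens T W X) Y Z =
    tensm T (idm W) (assoc T X Y Z) ∘ assoc T W (tens T X Y) Z
      ∘ tensm T (assoc T W X Y) (idm Z);
  triangle : forall X Y : C,
    tensm T (idm X) (lunit T Y) ∘ assoc T X (unit_obj T) Y =
    tensm T (runit T X) (idm Y)
}.

(* [Y], with evaluation [ev] and coevaluation [coev], is a left dual of [X]
   (equivalently, [X] is a right dual of [Y]). *)
Definition is_duality (K : closedFieldType) (C : linCategory K)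
    (T : tensorData C) (X Y : C)
    (ev : hom (tens T Y X) (unit_obj T))
    (coev : hom (unit_obj T) (tens T X Y)) : Prop :=
  runit T X ∘ tensm T (idm X) ev ∘ assoc T X Y X
    ∘ tensm T coev (idm X) ∘ lunitV T X = idm X
  /\
  lunit T Y ∘ tensm T ev (idm Y) ∘ assocV T Y X Y
    ∘ tensm T (idm Y) coev ∘ runitV T Y = idm Y.

(* Fusion categories: finite semisimple K-linear abelian rigid monoidal
   categories with simple unit. The family [simples] of representatives of the
   isomorphism classes of simple objects and the duals are part of the data. *)
Record fusionCategory (K : closedFieldType) := FusionCategory {
  fusion_lin :> linCategory K;
  fusion_abelian : is_abelian fusion_lin;
  fusion_semisimple : is_semisimple fusion_lin;
  rank : nat;
  simples : 'I_rank -> fusion_lin;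
  simples_simple : forall i, is_simple (simples i);
  simples_inj : forall i j, isomorphic (simples i) (simples j) -> i = j;
  simples_surj : forall X : fusion_lin,
    is_simple X -> exists i, isomorphic X (simples i);
  tensor : tensorData fusion_lin;
  fusion_monoidal : is_monoidal tensor;
  unit_simple : is_simple (unit_obj tensor);
  ldual : fusion_lin -> fusion_lin;
  ev : forall X, hom (tens tensor (ldual X) X) (unit_obj tensor);
  coev : forall X, hom (unit_obj tensor) (tens tensor X (ldual X));
  ldualP : forall X, is_duality (ev X) (coev X);
  rdual : fusion_lin -> fusion_lin;
  rev : forall X, hom (tens tensor X (rdual X)) (unit_obj tensor);
  rcoev : forall X, hom (unit_obj tensor) (tens tensor (rdual X) X);
  rdualP : forall X, is_duality (rev X) (rcoev X)
}.
Arguments rank {K} C : rename.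
Arguments simples {K} C i : rename.
Arguments tensor {K} C : rename.
Arguments ldual {K C} X : rename.
Arguments ev {K C} X : rename.
Arguments coev {K C} X : rename.
Arguments rdual {K C} X : rename.
Arguments rev {K C} X : rename.
Arguments rcoev {K C} X : rename.

Notation "X ⊗ Y" := (tens (tensor _) X Y) : cat_scope.
Notation "f ⊗₁ g" := (tensm (tensor _) f g) : cat_scope.
Notation one C := (unit_obj (tensor C)).

Section Fusion.
Variables (K : closedFieldType) (C : fusionCategory K).
Implicit Types X Y Z : C.

Local Notation a X Y Z := (assoc (tensor C) X Y Z).
Local Notation aV X Y Z := (assocV (tensor C) X Y Z).

Definition dualm X Y (f : hom X Y) : hom (ldual Y) (ldual X) :=
  lunit (tensor C) (ldual X)
    ∘ (ev Y ⊗₁ idm (ldual X))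
    ∘ ((idm (ldual Y) ⊗₁ f) ⊗₁ idm (ldual X))
    ∘ aV (ldual Y) X (ldual X)
    ∘ (idm (ldual Y) ⊗₁ coev X)
    ∘ runitV (tensor C) (ldual Y).

Definition is_invertible X : Prop :=
  exists Y, isomorphic (X ⊗ Y) (one C) /\ isomorphic (Y ⊗ X) (one C).

Definition is_perfect : Prop :=
  forall X, is_simple X -> is_invertible X -> isomorphic X (one C).

Definition is_braiding (c : forall X Y, hom (X ⊗ Y) (Y ⊗ X)) : Prop :=
  [/\ forall X Y, is_iso (c X Y),
      forall X X' Y Y' (f : hom X X') (g : hom Y Y'),
        c X' Y' ∘ (f ⊗₁ g) = (g ⊗₁ f) ∘ c X Y,
      forall X Y Z,
        a Y Z X ∘ c X (Y ⊗ Z) ∘ a X Y Z =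
        (idm Y ⊗₁ c X Z) ∘ a Y X Z ∘ (c X Y ⊗₁ idm Z)
    & forall X Y Z,
        aV Z X Y ∘ c (X ⊗ Y) Z ∘ aV X Y Z =
        (c X Z ⊗₁ idm Y) ∘ aV X Z Y ∘ (idm X ⊗₁ c Y Z)].

Definition is_ribbon (c : forall X Y, hom (X ⊗ Y) (Y ⊗ X))
    (theta : forall X, hom X X) : Prop :=
  [/\ forall X, is_iso (theta X),
      forall X Y (f : hom X Y), theta Y ∘ f = f ∘ theta X,
      forall X Y,
        theta (X ⊗ Y) = c Y X ∘ c X Y ∘ (theta X ⊗₁ theta Y)
    & forall X, theta (ldual X) = dualm (theta X)].

(* Trace with respect to the spherical structure defined by the twist. *)
Definition ribbon_trace (c : forall X Y, hom (X ⊗ Y) (Y ⊗ X))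
    (theta : forall X, hom X X) X (f : hom X X) : hom (one C) (one C) :=
  ev X ∘ c X (ldual X) ∘ ((theta X ∘ f) ⊗₁ idm (ldual X)) ∘ coev X.

(* The scalar [s] such that [f = s *: idm (one C)]; since [K] is algebraically
   closed and the unit is simple, End(1) is one-dimensional. *)
Definition unit_scalar (f : hom (one C) (one C)) : K :=
  coord [tuple idm (one C)] ord0 f.

Definition S_matrix (c : forall X Y, hom (X ⊗ Y) (Y ⊗ X))
    (theta : forall X, hom X X) : 'M[K]_(rank C) :=
  \matrix_(i, j) unit_scalar
    (ribbon_trace c theta
       (c (simples C j) (simples C i) ∘ c (simples C i) (simples C j))).

End Fusion.

Record modularCategory (K : closedFieldType) := ModularCategory {
  modular_fusion :> fusionCategory K;
  braid : forall X Y : modular_fusion, hom (X ⊗ Y) (Y ⊗ X);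
  twist : forall X : modular_fusion, hom X X;
  braidP : is_braiding braid;
  twistP : is_ribbon braid twist;
  S_nondegenerate : S_matrix braid twist \in unitmx
}.

Section FrobeniusPerron.
Variables (R : realType) (C : fusionCategory R[i]).

(* Matrix of multiplication by [X] in the Grothendieck ring; the multiplicity
   of a simple [S] in [Y] is dim Hom(S, Y). *)
Definition fusion_matrix (X : C) : 'M[R]_(rank C) :=
  \matrix_(i, j) (\dim {: hom (simples C j) (X ⊗ simples C i)})%:R.

(* The largest nonnegative real eigenvalue; the supremum is over a finite set,
   nonempty by the Frobenius-Perron theorem. *)
Definition FPdim (X : C) : R :=
  sup [set r : R | 0 <= r /\ eigenvalue (fusion_matrix X) r]%classic.

Definition FPdim_cat : R := \sum_(i < rank C) FPdim (simples C i) ^+ 2.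

Definition is_integral : Prop :=
  forall X : C, is_simple X -> FPdim X \is a Num.int.

End FrobeniusPerron.
Arguments FPdim_cat {R} C.

(* [x] is an integer divisible by [n]. Dimensions are real numbers, so their
   divisibility is expressed in the subring of integers of [R]. *)
Definition int_divides (R : realType) (n : nat) (x : R) : Prop :=
  exists k : int, x = (k * n%:Z)%:~R.

Definition prime_divisors (R : realType) (x : R) : set nat :=
  [set p : nat | prime p /\ int_divides p x]%classic.

(* Main.v *)
Require Import Defs.
From HB Require Import structures.
From mathcomp Require Import all_boot all_order all_algebra.
From mathcomp Require Import ring.
From mathcomp Require Import boolp classical_sets reals.

(** Let [T i j = s_ij / d_j]; its columns are the characters [X_i |-> T i j] of
    the Grothendieck ring. They are orthogonal, with square lengths [c_j], and
    symmetry of [s] makes [c_j * |d_j|^2] constant. One of the columns, say the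
    [k]-th, is the Frobenius-Perron dimension [m_i].

    - Since [c_j * m_j^2 = n * |T k j|^2] with [n = FPdim C], the vector
      [(T i o)_i] attached to the unit object [o] spans the kernel of an integer
      matrix as soon as [o] is the only index with [m_j = 1] (perfectness).
      Hence the [T i o] are rational integers, and comparing sums of squares
      gives [k = o]. Therefore [c_j = n / m_j^2] for all [j]; being an algebraic
      integer, it is an integer, that is [m_j^2] divides [n].
    - For [i != o] some [T i j] vanishes: otherwise [|T i j|^2], weighted by
      [m_j^2], has arithmetic mean [1] and geometric mean at least [1], so it is
      constantly [1], and [m_i = 1].
    - By symmetry every character other than the [o]-th thus kills some simple
      object. Their product [x] satisfies [m(x) = n * [x : 1]], where [[x : 1]]
      is the multiplicity of the unit, so [n] divides a product of [m_i]'s. *)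

Section Preliminaries.
Set Implicit Arguments.
Unset Strict Implicit.

Lemma choice_dep (T : Type) (U : T -> Type) (P : forall t, U t -> Prop) :
  (forall t, exists u, P t u) -> exists f : forall t, U t, forall t, P t (f t).
Proof. by move=> e; exists (fun t => sval (cid (e t))) => t; case: cid. Qed.

Lemma prime_dvd_prod_seq (I : eqType) (p : nat) (s : seq I) (m : I -> nat) :
  prime p -> p %| \prod_(i <- s) m i -> exists i, p %| m i.
Proof.
move=> pp; elim: s => [|i s IH]; first by rewrite big_nil dvdn1; case: eqP pp => // ->.
by rewrite big_cons Euclid_dvdM // => /orP [pi|/IH //]; exists i.
Qed.

End Preliminaries.

(** * Graphical calculus *)

(* Diagrams are drawn without associators: a morphism between words of objects
   is represented by its natural family of instances on right-nested tensor
   products [X1 ⊗ (X2 ⊗ (... ⊗ W))]. These are the maps [evw], [cow], [bw].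
   They are locked because unification would otherwise unfold them when
   rewriting with the associativity of composition. *)
Fact lockkey : unit. Proof. exact: tt. Qed.

Section Calculus.
Set Implicit Arguments.
Unset Strict Implicit.
Import GRing.Theory Defs.
Local Open Scope ring_scope.
Local Open Scope cat_scope.
Local Notation "f • g" := (comp f g) (at level 41, right associativity).
Variables (K : closedFieldType) (C : fusionCategory K).
Implicit Types A B D W X Y Z : C.

Local Notation "A ◁ f" := (idm A ⊗₁ f) (at level 39, left associativity).
Local Notation "f ▷ W" := (f ⊗₁ idm W) (at level 39, left associativity).
Local Notation T := (tensor C).
Local Notation a X Y Z := (assoc T X Y Z).
Local Notation aV X Y Z := (assocV T X Y Z).
Local Notation lu X := (lunit T X).
Local Notation luV X := (lunitV T X).
Local Notation ru X := (runit T X).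
Local Notation ruV X := (runitV T X).
Local Notation I := (unit_obj T).

(* Right-nested composites are rewritten at any depth by letting both sides of
   an equation act on an arbitrary morphism [x]. *)
Lemma eq_comp21 X Y Z Z' (f : hom Y Z) (g : hom X Y) (h : hom X Z) :
  f • g = h -> forall x : hom Z' X, f • g • x = h • x.
Proof. by move=> e x; rewrite compmA e. Qed.

Lemma eq_comp31 X Y Y' Z Z' (f : hom Y Z) (g : hom Y' Y) (k : hom X Y')
    (h : hom X Z) :
  f • g • k = h -> forall x : hom Z' X, f • g • k • x = h • x.
Proof. by move=> e x; rewrite !compmA -(compmA f) e. Qed.

Lemma eq_comp22 X Y Y' Z Z' (f : hom Y Z) (g : hom X Y) (f' : hom Y' Z)
    (g' : hom X Y') :
  f • g = f' • g' -> forall x : hom Z' X, f • g • x = f' • g' • x.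
Proof. by move=> e x; rewrite compmA e -compmA. Qed.

Lemma cancel_split_mono X Y Z (g : hom Z Y) (f : hom Y Z) (u v : hom X Y) :
  g • f = idm Y -> f • u = f • v -> u = v.
Proof. by move=> e e'; rewrite -[u]comp1m -[v]comp1m -e -?compmA e'. Qed.

Lemma cancel_split_epi X Y Z (g : hom X Y) (f : hom Y X) (u v : hom X Z) :
  f • g = idm X -> u • f = v • f -> u = v.
Proof. by move=> e e'; rewrite -[u]compm1 -[v]compm1 -e !compmA e'. Qed.

(** * Whiskering and coherence in a monoidal category *)

Let MP := fusion_monoidal C.

Lemma whiskL_id X Y : X ◁ idm Y = idm (X ⊗ Y). Proof. exact: tensm_id MP _ _. Qed.

Lemma whiskL_comp A X Y Z (g : hom Y Z) (f : hom X Y) :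
  A ◁ (g • f) = (A ◁ g) • (A ◁ f).
Proof. by rewrite -(tensm_comp MP) comp1m. Qed.

Lemma whiskR_comp A X Y Z (g : hom Y Z) (f : hom X Y) :
  (g • f) ▷ A = (g ▷ A) • (f ▷ A).
Proof. by rewrite -(tensm_comp MP) comp1m. Qed.

Lemma whisk_exch X Y W W' (f : hom X Y) (g : hom W W') :
  (f ▷ W') • (X ◁ g) = (Y ◁ g) • (f ▷ W).
Proof. by rewrite -!(tensm_comp MP) !comp1m !compm1. Qed.

Lemma aVa X Y Z : aV X Y Z • a X Y Z = idm _. Proof. exact: assocK MP _ _ _. Qed.
Lemma aaV X Y Z : a X Y Z • aV X Y Z = idm _. Proof. exact: assocVK MP _ _ _. Qed.
Lemma luVlu X : luV X • lu X = idm _. Proof. exact: lunitK MP _. Qed.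
Lemma luluV X : lu X • luV X = idm _. Proof. exact: lunitVK MP _. Qed.
Lemma ruVru X : ruV X • ru X = idm _. Proof. exact: runitK MP _. Qed.
Lemma ruruV X : ru X • ruV X = idm _. Proof. exact: runitVK MP _. Qed.

Lemma aVaK X Y Z U (x : hom U _) : aV X Y Z • a X Y Z • x = x.
Proof. by rewrite compmA aVa comp1m. Qed.
Lemma aaVK X Y Z U (x : hom U _) : a X Y Z • aV X Y Z • x = x.
Proof. by rewrite compmA aaV comp1m. Qed.
Lemma luluVK X U (x : hom U _) : lu X • luV X • x = x.
Proof. by rewrite compmA luluV comp1m. Qed.

Section WhiskerCancel.
Variables (X Y Z : C) (f : hom Y Z) (g : hom Z Y).
Hypothesis gf : g • f = idm Y.
Lemma whiskLK : (X ◁ g) • (X ◁ f) = idm _.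
Proof. by rewrite -whiskL_comp gf whiskL_id. Qed.
Lemma whiskRK : (g ▷ X) • (f ▷ X) = idm _.
Proof. by rewrite -whiskR_comp gf whiskL_id. Qed.
Lemma whiskLKx U (x : hom U _) : (X ◁ g) • (X ◁ f) • x = x.
Proof. by rewrite compmA whiskLK comp1m. Qed.
Lemma whiskRKx U (x : hom U _) : (g ▷ X) • (f ▷ X) • x = x.
Proof. by rewrite compmA whiskRK comp1m. Qed.
End WhiskerCancel.

Lemma aR X X' Y Z (f : hom X X') :
  a X' Y Z • ((f ▷ Y) ▷ Z) = (f ▷ (Y ⊗ Z)) • a X Y Z.
Proof. by rewrite (assoc_natural MP) whiskL_id. Qed.
Lemma aM X Y Y' Z (f : hom Y Y') :
  a X Y' Z • ((X ◁ f) ▷ Z) = (X ◁ (f ▷ Z)) • a X Y Z.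
Proof. by rewrite (assoc_natural MP). Qed.
Lemma aL X Y Z Z' (f : hom Z Z') :
  a X Y Z' • ((X ⊗ Y) ◁ f) = (X ◁ (Y ◁ f)) • a X Y Z.
Proof. by rewrite -(assoc_natural MP) whiskL_id. Qed.

Lemma aV_exch X Y Z X' Y' Z' (f : hom (X ⊗ Y ⊗ Z) (X' ⊗ Y' ⊗ Z')) g :
  a X' Y' Z' • f = g • a X Y Z -> aV X' Y' Z' • g = f • aV X Y Z.
Proof.
move=> e; apply: (cancel_split_mono (aVa X' Y' Z')).
by rewrite compmA aaV comp1m compmA e -compmA aaV compm1.
Qed.

Lemma aVR X X' Y Z (f : hom X X') :
  aV X' Y Z • (f ▷ (Y ⊗ Z)) = ((f ▷ Y) ▷ Z) • aV X Y Z.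
Proof. exact/aV_exch/aR. Qed.
Lemma aVM X Y Y' Z (f : hom Y Y') :
  aV X Y' Z • (X ◁ (f ▷ Z)) = ((X ◁ f) ▷ Z) • aV X Y Z.
Proof. exact/aV_exch/aM. Qed.
Lemma aVL X Y Z Z' (f : hom Z Z') :
  aV X Y Z' • (X ◁ (Y ◁ f)) = ((X ⊗ Y) ◁ f) • aV X Y Z.
Proof. exact/aV_exch/aL. Qed.

Lemma luN X Y (f : hom X Y) : lu Y • (I ◁ f) = f • lu X.
Proof. exact: lunit_natural MP _ _ _. Qed.
Lemma luVN X Y (f : hom X Y) : luV Y • f = (I ◁ f) • luV X.
Proof.
apply: (cancel_split_mono (luVlu Y)).
by rewrite luluVK (eq_comp22 (luN f)) luluV compm1.
Qed.
Lemma ruN X Y (f : hom X Y) : ru Y • (f ▷ I) = f • ru X.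
Proof. exact: runit_natural MP _ _ _. Qed.

Lemma pent W X Y Z :
  a W X (Y ⊗ Z) • a (W ⊗ X) Y Z =
  (W ◁ a X Y Z) • a W (X ⊗ Y) Z • (a W X Y ▷ Z).
Proof. by rewrite (pentagon MP) -compmA. Qed.

Lemma pentV W X Y Z :
  (W ◁ aV X Y Z) • a W X (Y ⊗ Z) • a (W ⊗ X) Y Z =
  a W (X ⊗ Y) Z • (a W X Y ▷ Z).
Proof. by rewrite pent whiskLKx // aVa. Qed.

Lemma pentV2 W X Y Z :
  aV W X (Y ⊗ Z) • (W ◁ a X Y Z) • a W (X ⊗ Y) Z =
  a (W ⊗ X) Y Z • (aV W X Y ▷ Z).
Proof.
apply: (cancel_split_mono (aVa W X (Y ⊗ Z))).
rewrite aaVK (eq_comp21 (pent _ _ _ _)) -?compmA whiskRK ?compm1 //; exact: aaV.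
Qed.

Lemma tri X Y : (X ◁ lu Y) • a X I Y = ru X ▷ Y.
Proof. exact: triangle MP _ _. Qed.

Lemma triV X Y : a X I Y • (ruV X ▷ Y) = X ◁ luV Y.
Proof.
apply: (cancel_split_mono (whiskLK X (luVlu Y))).
rewrite (eq_comp21 (tri _ _)) !whiskRK ?whiskLK //; [exact: luluV | exact: ruruV].
Qed.

Lemma whisk1_inj X Y (f g : hom X Y) : I ◁ f = I ◁ g -> f = g.
Proof.
move=> e; apply: (cancel_split_epi (luluV X)).
by rewrite -!luN e.
Qed.

(* Kelly's consequence of the pentagon and triangle axioms. *)
Lemma lu_tens X Y : lu (X ⊗ Y) • a I X Y = lu X ▷ Y.
Proof.
apply: whisk1_inj.
apply: (cancel_split_epi (aaV I (I ⊗ X) Y)).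
apply: (cancel_split_epi (whiskRK Y (aaV I I X))).
rewrite -?compmA whiskL_comp -?compmA -pent (eq_comp21 (tri _ _)) -aR.
by rewrite (eq_comp22 (esym (aM _ _ _))) -whiskR_comp tri.
Qed.

Lemma luV_tens X Y : a I X Y • (luV X ▷ Y) = luV (X ⊗ Y).
Proof.
apply: (cancel_split_mono (luVlu (X ⊗ Y))).
rewrite (eq_comp21 (lu_tens _ _)) whiskRK ?luluV //; exact: luluV.
Qed.

(** * Evaluations, coevaluations and the snake identities *)

Definition evw A W : hom (ldual A ⊗ (A ⊗ W)) W :=
  locked_with lockkey (lu W • (ev A ▷ W) • aV (ldual A) A W).
Lemma evwE A W : evw A W =
  lu W • (ev A ▷ W) • aV (ldual A) A W.
Proof. exact: locked_withE. Qed.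
Definition cow A W : hom W (A ⊗ (ldual A ⊗ W)) :=
  locked_with lockkey (a A (ldual A) W • (coev A ▷ W) • luV W).
Lemma cowE A W : cow A W =
  a A (ldual A) W • (coev A ▷ W) • luV W.
Proof. exact: locked_withE. Qed.

Lemma evwN A W W' (f : hom W W') :
  evw A W' • (ldual A ◁ (A ◁ f)) = f • evw A W.
Proof.
rewrite !evwE -?compmA aVL (eq_comp22 (whisk_exch _ _)) (eq_comp22 (luN f)).
by rewrite -?compmA.
Qed.

Lemma cowN A W W' (f : hom W W') :
  (A ◁ (ldual A ◁ f)) • cow A W = cow A W' • f.
Proof.
rewrite !cowE -?compmA luVN (eq_comp22 (whisk_exch _ _)).
by rewrite (eq_comp22 (aL _ _ _)) -?compmA.
Qed.

(** The identity is expanded into the duality axiom for [A] whiskered by [W]; the pentagon, the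
    triangle and the unit coherence then absorb the associators. *)
Lemma zigzag1 A W : (A ◁ evw A W) • cow A (A ⊗ W) = idm (A ⊗ W).
Proof.
have [z _] := ldualP A.
rewrite -whiskL_id -{2}z !evwE !cowE !whiskL_comp !whiskR_comp -?compmA.
rewrite -(luV_tens A W) (eq_comp22 (esym (aR _ _ _))) (eq_comp31 (pentV _ _ _ _)) -?compmA.
by rewrite (eq_comp22 (esym (aM _ _ _))) (eq_comp21 (tri _ _)).
Qed.

Lemma zigzag2 A W : evw A (ldual A ⊗ W) • (ldual A ◁ cow A W) = idm (ldual A ⊗ W).
Proof.
have [_ z] := ldualP A.
rewrite -whiskL_id -{2}z !evwE !cowE !whiskL_comp !whiskR_comp -?compmA.
rewrite -(triV (ldual A) W) (eq_comp22 (esym (aM _ _ _))) (eq_comp31 (pentV2 _ _ _ _)) -?compmA.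
by rewrite (eq_comp22 (esym (aR _ _ _))) (eq_comp21 (lu_tens _ _)) -?compmA.
Qed.

Lemma whisk_lin_l X Y W (s : K) (f g : hom X Y) :
  (s *: f + g) ▷ W = s *: (f ▷ W) + (g ▷ W).
Proof. exact: tensm_linear_l MP _ _ _ _ _ _ _ _. Qed.
Lemma whisk_lin_r A X Y (s : K) (f g : hom X Y) :
  A ◁ (s *: f + g) = s *: (A ◁ f) + (A ◁ g).
Proof. exact: tensm_linear_r MP _ _ _ _ _ _ _ _. Qed.

(** * Braidings *)

Section Braided.
Variable c : forall X Y, hom (X ⊗ Y) (Y ⊗ X).
Hypothesis cP : is_braiding c.

Definition bw A B W : hom (A ⊗ (B ⊗ W)) (B ⊗ (A ⊗ W)) :=
  locked_with lockkey (a B A W • (c A B ▷ W) • aV A B W).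
Lemma bwE A B W : bw A B W =
  a B A W • (c A B ▷ W) • aV A B W.
Proof. exact: locked_withE. Qed.

Lemma cN X X' Y Y' (f : hom X X') (g : hom Y Y') :
  c X' Y' • (f ⊗₁ g) = (g ⊗₁ f) • c X Y.
Proof. by case: cP. Qed.

Lemma bwN A B W W' (f : hom W W') :
  bw A B W' • (A ◁ (B ◁ f)) = (B ◁ (A ◁ f)) • bw A B W.
Proof.
rewrite !bwE -?compmA aVL (eq_comp22 (whisk_exch _ _)) (eq_comp22 (aL _ _ _)).
by rewrite -?compmA.
Qed.

Lemma bwNl A A' B W (f : hom A A') :
  bw A' B W • (f ▷ (B ⊗ W)) = (B ◁ (f ▷ W)) • bw A B W.
Proof.
rewrite !bwE -?compmA aVR (eq_comp21 (esym (whiskR_comp _ _ _))) cN whiskR_comp.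
by rewrite -?compmA (eq_comp22 (aM _ _ _)) -?compmA.
Qed.

Lemma bwNr A B B' W (f : hom B B') :
  bw A B' W • (A ◁ (f ▷ W)) = (f ▷ (A ⊗ W)) • bw A B W.
Proof.
rewrite !bwE -?compmA aVM (eq_comp21 (esym (whiskR_comp _ _ _))) cN whiskR_comp.
by rewrite -?compmA (eq_comp22 (aR _ _ _)) -?compmA.
Qed.

Lemma bw_tensr A B D W :
  a B D (A ⊗ W) • bw A (B ⊗ D) W =
  (B ◁ bw A D W) • bw A B (D ⊗ W) • (A ◁ a B D W).
Proof.
have [_ _ hex _] := cP.
apply: (cancel_split_epi (aaV A (B ⊗ D) W)).
apply: (cancel_split_epi (whiskRK W (aaV A B D))).
rewrite !bwE !whiskL_comp -?compmA -pent aVaK aVaK.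
rewrite -aR (eq_comp31 (pentV _ _ _ _)) -?compmA.
rewrite (eq_comp22 (esym (aM _ _ _))) (eq_comp21 (pent _ _ _ _)) -?compmA.
by do !rewrite -whiskR_comp; rewrite [_ • c _ _ • _]compmA hex -?compmA.
Qed.

Lemma bw_tensl A B D W :
  (D ◁ a A B W) • bw (A ⊗ B) D W =
  bw A D (B ⊗ W) • (A ◁ bw B D W) • a A B (D ⊗ W).
Proof.
have [_ _ _ hex] := cP.
apply: (cancel_split_epi (aaV (A ⊗ B) D W)).
rewrite !bwE !whiskL_comp -?compmA aVa compm1 pentV.
rewrite (eq_comp22 (esym (aM _ _ _))) (eq_comp31 (pentV2 _ _ _ _)) -?compmA.
rewrite (eq_comp22 (esym (aR _ _ _))) (eq_comp21 (pent _ _ _ _)) -?compmA.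
do !rewrite -whiskR_comp.
have -> : (c A D ⊗₁ idm B) • aV A D B • (A ◁ c B D) • a A B D =
  aV D A B • c (A ⊗ B) D.
  by rewrite !compmA -hex -?compmA aVa compm1.
by rewrite aaVK.
Qed.

(** Crossing the unit is trivial. In the hexagon for a strand crossing [I ⊗ I], collapsing one unit
    leaves a crossing with [I] on both sides, which is invertible and cancels. This treats
    [W = I ⊗ V], and naturality of [lu] gives the general case. *)
Lemma bw_unit A W : lu (A ⊗ W) • bw A I W = A ◁ lu W.
Proof.
suff lu1 V : lu (A ⊗ (I ⊗ V)) • bw A I (I ⊗ V) = A ◁ lu (I ⊗ V).
  apply: (cancel_split_epi (whiskLK A (whiskLK I (luluV W)))).
  by rewrite -compmA bwN (eq_comp22 (luN _)) lu1 -!whiskL_comp luN.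
have [cisoP _ _ _] := cP.
have [g [gc cg]] := cisoP A I.
have bwV : (a A I V • (g ▷ V) • aV I A V) • bw A I V = idm _.
  by rewrite !bwE -?compmA aVaK whiskRKx // aaV.
apply: (cancel_split_mono (f := bw A I V) bwV).
apply: (cancel_split_epi (whiskLK A (aaV I I V))).
rewrite -?compmA -whiskL_comp lu_tens bwNr // -lu_tens -compmA bw_tensr //.
by rewrite (eq_comp22 (luN _)).
Qed.

Lemma bw_unitV A W : bw A I W • (A ◁ luV W) = luV (A ⊗ W).
Proof.
apply: (cancel_split_mono (luVlu _)).
by rewrite (eq_comp21 (bw_unit _ _)) luluV -whiskL_comp luluV whiskL_id.
Qed.

(** The hexagon merges the two crossings into one with [X ⊗ ldual X]; naturality pulls the cup
    through it and leaves a crossing with the unit. *)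
Lemma slide_co X A W :
  (X ◁ bw A (ldual X) W) • bw A X (ldual X ⊗ W) • (A ◁ cow X W) =
  cow X (A ⊗ W).
Proof.
rewrite !cowE !whiskL_comp (eq_comp31 (esym (bw_tensr _ _ _ _))) -?compmA.
by rewrite (eq_comp22 (bwNr _ _ _)) bw_unitV.
Qed.

Lemma slide_ev X A W :
  evw X (A ⊗ W) • (ldual X ◁ bw A X W) • bw A (ldual X) (X ⊗ W) =
  A ◁ evw X W.
Proof.
rewrite !evwE !whiskL_comp -?compmA.
have -> : (ldual X ◁ bw A X W) • bw A (ldual X) (X ⊗ W) =
   a (ldual X) X (A ⊗ W) • bw A (ldual X ⊗ X) W • (A ◁ aV (ldual X) X W).
  by rewrite compmA bw_tensr -?compmA (whiskLK _ (aaV _ _ _)) compm1.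
by rewrite aVaK (eq_comp22 (esym (bwNr _ _ _))) (eq_comp21 (bw_unit _ _)).
Qed.

(** Two crossings of [A] merge into one crossing with [B ⊗ D], and the braiding of [B] with [D]
    passes through it by naturality. *)
Lemma yang_baxter A B D W :
  bw B D (A ⊗ W) • (B ◁ bw A D W) • bw A B (D ⊗ W) =
  (D ◁ bw A B W) • bw A D (B ⊗ W) • (A ◁ bw B D W).
Proof.
have -> : (B ◁ bw A D W) • bw A B (D ⊗ W) =
   a B D (A ⊗ W) • bw A (B ⊗ D) W • (A ◁ aV B D W).
  by rewrite compmA bw_tensr -?compmA (whiskLK _ (aaV _ _ _)) compm1.
rewrite {1}bwE -?compmA aVaK (eq_comp22 (esym (bwNr _ _ _))).
by rewrite (eq_comp21 (bw_tensr _ _ _ _)) -?compmA -!whiskL_comp -bwE.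
Qed.

(** * Twists, partial traces and the double braiding *)

Section Ribbon.
Variable theta : forall X, hom X X.
Hypothesis thetaP : is_ribbon c theta.

Lemma thetaN X Y (f : hom X Y) : theta Y • f = f • theta X.
Proof. by case: thetaP. Qed.

Lemma theta_tens A B W :
  a A B W • (theta (A ⊗ B) ▷ W) =
  bw B A W • bw A B W • (theta A ▷ (B ⊗ W)) • (A ◁ (theta B ▷ W)) • a A B W.
Proof.
have [_ _ -> _] := thetaP.
have -> : theta A ⊗₁ theta B = (theta A ▷ B) • (A ◁ theta B).
  by rewrite -(tensm_comp MP) comp1m compm1.
rewrite !bwE !whiskR_comp -?compmA aVaK -aM (eq_comp22 (esym (aR _ _ _))).
by rewrite aVaK.
Qed.

(** The coevaluation of the opposite handedness in the pivotal structure of the twist: coevaluate,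
    twist [A], and cross it over its dual. *)
Definition cotw A W : hom W (ldual A ⊗ (A ⊗ W)) :=
  locked_with lockkey (bw A (ldual A) W • (theta A ▷ (ldual A ⊗ W)) • cow A W).
Lemma cotwE A W : cotw A W =
  bw A (ldual A) W • (theta A ▷ (ldual A ⊗ W)) • cow A W.
Proof. exact: locked_withE. Qed.

Lemma cotwN A W W' (f : hom W W') :
  (ldual A ◁ (A ◁ f)) • cotw A W = cotw A W' • f.
Proof.
rewrite !cotwE -?compmA (eq_comp22 (esym (bwN _ _ _))).
by rewrite (eq_comp22 (esym (whisk_exch _ _))) cowN.
Qed.

(* Partial trace over the left tensor factor. *)
Definition ptr A W W' (psi : hom (A ⊗ W) (A ⊗ W')) : hom W W' :=
  locked_with lockkey (evw A W' • (ldual A ◁ psi) • cotw A W).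
Lemma ptrE A W W' (psi : hom (A ⊗ W) (A ⊗ W')) : ptr psi =
  evw A W' • (ldual A ◁ psi) • cotw A W.
Proof. exact: locked_withE. Qed.

Lemma ptr_natural A W W' V V' (psi : hom (A ⊗ W) (A ⊗ W')) (f : hom V W)
    (g : hom W' V') :
  ptr ((A ◁ g) • psi • (A ◁ f)) = g • ptr psi • f.
Proof.
by rewrite !ptrE !whiskL_comp -?compmA (eq_comp22 (evwN _ _)) cotwN.
Qed.

Section TensorDual.
Variables A X : C.
Local Notation P := (A ⊗ X).
Local Notation P' := (ldual (A ⊗ X)).
Local Notation A' := (ldual A).
Local Notation X' := (ldual X).

Definition evP W : hom (P' ⊗ (A ⊗ (X ⊗ W))) W :=
  locked_with lockkey (evw P W • (P' ◁ aV A X W)).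
Lemma evPE W : evP W =
  evw P W • (P' ◁ aV A X W).
Proof. exact: locked_withE. Qed.
Definition coP W : hom W (A ⊗ (X ⊗ (P' ⊗ W))) :=
  locked_with lockkey (a A X (P' ⊗ W) • cow P W).
Lemma coPE W : coP W =
  a A X (P' ⊗ W) • cow P W.
Proof. exact: locked_withE. Qed.
Definition coXA W : hom W (A ⊗ (X ⊗ (X' ⊗ (A' ⊗ W)))) :=
  locked_with lockkey ((A ◁ cow X (A' ⊗ W)) • cow A W).
Lemma coXAE W : coXA W =
  (A ◁ cow X (A' ⊗ W)) • cow A W.
Proof. exact: locked_withE. Qed.
(** The canonical comparison from the dual of a product to the product of the duals in reverse
    order. It turns the cup and cap of [A ⊗ X] into nested cups and caps. *)
Definition dual_tens W : hom (P' ⊗ W) (X' ⊗ (A' ⊗ W)) :=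
  locked_with lockkey (evP (X' ⊗ (A' ⊗ W)) • (P' ◁ coXA W)).
Lemma dual_tensE W : dual_tens W =
  evP (X' ⊗ (A' ⊗ W)) • (P' ◁ coXA W).
Proof. exact: locked_withE. Qed.

Lemma evPN W W' (f : hom W W') :
  evP W' • (P' ◁ (A ◁ (X ◁ f))) = f • evP W.
Proof.
rewrite !evPE -?compmA -whiskL_comp aVL whiskL_comp.
by rewrite (eq_comp22 (evwN _ _)).
Qed.

Lemma coPN W W' (f : hom W W') :
  (A ◁ (X ◁ (P' ◁ f))) • coP W = coP W' • f.
Proof. by rewrite !coPE -?compmA (eq_comp22 (esym (aL _ _ _))) cowN. Qed.

Lemma zigzagP W : (A ◁ (X ◁ evP W)) • coP (A ⊗ (X ⊗ W)) = idm _.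
Proof.
rewrite !evPE !coPE !whiskL_comp -?compmA !(eq_comp22 (esym (aL _ _ _))).
by rewrite cowN (eq_comp21 (zigzag1 _ _)) comp1m aaV.
Qed.

Lemma dual_tensN W W' (f : hom W W') :
  (X' ◁ (A' ◁ f)) • dual_tens W = dual_tens W' • (P' ◁ f).
Proof.
rewrite !dual_tensE -?compmA (eq_comp22 (esym (evPN _))) -!whiskL_comp.
rewrite !coXAE (eq_comp21 (esym (whiskL_comp _ _ _))) cowN.
by rewrite (whiskL_comp A) -?compmA cowN.
Qed.

Lemma dual_tens_ev W :
  evw X W • (X' ◁ evw A (X ⊗ W)) • dual_tens (A ⊗ (X ⊗ W)) = evP W.
Proof.
rewrite !dual_tensE (eq_comp22 (esym (evPN _))) (eq_comp22 (esym (evPN _))).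
rewrite -[RHS]compm1 -whiskL_id -!whiskL_comp !coXAE.
rewrite [(A ◁ (X ◁ (X' ◁ _))) • _](eq_comp21 (esym (whiskL_comp _ _ _))) cowN.
rewrite (whiskL_comp A) -?compmA zigzag1 compm1 -(whiskL_comp A) zigzag1.
by rewrite !whiskL_id.
Qed.

Lemma dual_tens_co W : (A ◁ (X ◁ dual_tens W)) • coP W = coXA W.
Proof.
by rewrite !dual_tensE !whiskL_comp -?compmA coPN (eq_comp21 (zigzagP _)) comp1m.
Qed.

Lemma slide_evP Y W :
  evP (Y ⊗ W) • (P' ◁ ((A ◁ bw Y X W) • bw Y A (X ⊗ W)))
    • bw Y P' (A ⊗ (X ⊗ W)) = Y ◁ evP W.
Proof.
have -> : (A ◁ bw Y X W) • bw Y A (X ⊗ W) =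
   a A X (Y ⊗ W) • bw Y P W • (Y ◁ aV A X W).
  by rewrite compmA bw_tensr -?compmA (whiskLK _ (aaV _ _ _)) compm1.
rewrite !evPE !whiskL_comp -?compmA (whiskLKx (aVa _ _ _)).
by rewrite -bwN (eq_comp31 (slide_ev _ _ _)).
Qed.

Lemma slide_dual_tens Y W :
  dual_tens (Y ⊗ W) • bw Y P' W =
  (X' ◁ bw Y A' W) • bw Y X' (A' ⊗ W) • (Y ◁ dual_tens W).
Proof.
rewrite !dual_tensE.
have -> : coXA (Y ⊗ W) = (A ◁ (X ◁ ((X' ◁ bw Y A' W) • bw Y X' (A' ⊗ W))))
   • ((A ◁ bw Y X (X' ⊗ (A' ⊗ W))) • bw Y A (X ⊗ (X' ⊗ (A' ⊗ W))))
   • (Y ◁ coXA W).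
  rewrite !coXAE -(slide_co A Y W) (eq_comp21 (esym (whiskL_comp _ _ _))) -cowN.
  rewrite -(slide_co X Y) !whiskL_comp -?compmA.
  by rewrite (eq_comp22 (esym (bwN _ _ _))).
rewrite !whiskL_comp -?compmA -bwN.
rewrite -[in RHS]slide_evP !whiskL_comp -?compmA.
by rewrite (eq_comp22 (evPN _)) (eq_comp22 (evPN _)).
Qed.

End TensorDual.

(* Multiplicativity of the pivotal structure, the only place where the twist of
   a tensor product is needed: [coev] of X is slid under the strand A, which
   unlinks the double braiding, and the Yang-Baxter move does the rest. *)
Lemma cotw_tens A X W :
  dual_tens A X (A ⊗ (X ⊗ W)) • (ldual (A ⊗ X) ◁ a A X W) • cotw (A ⊗ X) W =
  (ldual X ◁ cotw A (X ⊗ W)) • cotw X W.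
Proof.
have slideth : (A ◁ bw X (ldual A) W) • bw X A (ldual A ⊗ W)
    • (X ◁ ((theta A ▷ (ldual A ⊗ W)) • cow A W)) =
    (theta A ▷ (ldual A ⊗ (X ⊗ W))) • cow A (X ⊗ W).
  rewrite whiskL_comp (eq_comp22 (bwNr _ _ _)) (eq_comp22 (esym (whisk_exch _ _))).
  by rewrite slide_co.
have -> : (ldual X ◁ cotw A (X ⊗ W)) • cotw X W =
   (ldual X ◁ bw A (ldual A) (X ⊗ W)) • (ldual X ◁ (A ◁ bw X (ldual A) W))
   • (ldual X ◁ bw X A (ldual A ⊗ W)) • cotw X (A ⊗ (ldual A ⊗ W))
   • (theta A ▷ (ldual A ⊗ W)) • cow A W.
  by rewrite -cotwN {1}cotwE -slideth !whiskL_comp -?compmA.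
rewrite !cotwE (eq_comp21 (bw_tensl _ _ _ _)) -?compmA (eq_comp21 (theta_tens _ _ _)) -?compmA.
rewrite -coPE (eq_comp21 (slide_dual_tens _ _ _ _)) -?compmA.
rewrite [(A ◁ dual_tens _ _ _) • _](eq_comp21 (esym (whiskL_comp _ _ _))).
rewrite slide_dual_tens !whiskL_comp -?compmA.
rewrite !(eq_comp22 (esym (bwN _ _ _))) (eq_comp22 (esym (whisk_exch _ _))).
rewrite [(A ◁ (X ◁ dual_tens _ _ _)) • _](eq_comp21 (esym (whiskL_comp _ _ _))).
rewrite -whisk_exch whiskL_comp -?compmA dual_tens_co.
rewrite (eq_comp22 (bwN _ _ _)) (eq_comp31 (yang_baxter _ _ _ _)) -?compmA !coXAE.
rewrite (eq_comp22 (whisk_exch (theta A) _)) (eq_comp22 (whisk_exch (theta A) _)).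
rewrite (eq_comp22 (bwNr _ _ _)) (eq_comp22 (esym (whisk_exch (theta X) _))).
by rewrite (eq_comp31 (slide_co _ _ _)).
Qed.

(** By [cotw_tens] and [dual_tens_ev] the loop coloured [A ⊗ X] becomes two nested loops, the inner
    one coloured [A]. *)
Lemma ptr_tens A X W W' (psi : hom (A ⊗ (X ⊗ W)) (A ⊗ (X ⊗ W'))) :
  ptr (aV A X W' • psi • a A X W) = ptr (ptr psi).
Proof.
rewrite !ptrE !whiskL_comp -?compmA -cotw_tens (eq_comp22 (dual_tensN _ _ _)).
by rewrite (eq_comp31 (dual_tens_ev _ _ _)) evPE -compmA.
Qed.

Section Cyclicity.
Variables (A B : C) (g : hom B A).
Local Notation A' := (ldual A).
Local Notation B' := (ldual B).

(** The transpose of [g], in the context [W]. *)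
Definition dualw W : hom (A' ⊗ W) (B' ⊗ W) :=
  locked_with lockkey
    (evw A (B' ⊗ W) • (A' ◁ ((g ▷ (B' ⊗ W)) • cow B W))).
Lemma dualwE W :
  dualw W = evw A (B' ⊗ W) • (A' ◁ ((g ▷ (B' ⊗ W)) • cow B W)).
Proof. exact: locked_withE. Qed.

Lemma dualwN W W' (f : hom W W') :
  (B' ◁ f) • dualw W = dualw W' • (A' ◁ f).
Proof.
rewrite !dualwE -?compmA (eq_comp22 (esym (evwN _ _))) -!whiskL_comp.
by rewrite (eq_comp22 (esym (whisk_exch _ _))) cowN -?compmA.
Qed.

Lemma dualw_ev W : evw B W • dualw (B ⊗ W) = evw A W • (A' ◁ (g ▷ W)).
Proof.
rewrite !dualwE (eq_comp22 (esym (evwN _ _))) -whiskL_comp.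
by rewrite (eq_comp22 (esym (whisk_exch _ _))) zigzag1 compm1.
Qed.

Lemma dualw_co W : (A ◁ dualw W) • cow A W = (g ▷ (B' ⊗ W)) • cow B W.
Proof.
by rewrite !dualwE !(whiskL_comp A) -?compmA cowN (eq_comp21 (zigzag1 _ _)) comp1m.
Qed.

Lemma slide_dualw Y W :
  dualw (Y ⊗ W) • bw Y A' W = bw Y B' W • (Y ◁ dualw W).
Proof.
rewrite !dualwE -(slide_co B Y W) (eq_comp22 (whisk_exch _ _)).
rewrite (eq_comp22 (esym (bwNr _ _ _))) !whiskL_comp -?compmA.
rewrite (eq_comp22 (evwN _ _)) -slide_ev -?compmA.
by rewrite -bwN (eq_comp22 (esym (bwN _ _ _))) -?compmA.
Qed.

(** [g] travels around the loop: through the cap it becomes its transpose, which slides past the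
    crossing in [cotw] and returns to [g] at the cup, where it commutes with the twist. *)
Lemma ptr_cyclic W W' (psi : hom (A ⊗ W) (B ⊗ W')) :
  ptr ((g ▷ W') • psi) = ptr (psi • (g ▷ W)).
Proof.
rewrite !ptrE !whiskL_comp -?compmA (eq_comp22 (esym (dualw_ev _))).
rewrite (eq_comp22 (esym (dualwN _))) !cotwE (eq_comp22 (slide_dualw _ _)).
rewrite (eq_comp22 (esym (whisk_exch _ _))) dualw_co.
rewrite (eq_comp21 (esym (whiskR_comp _ _ _))) thetaN whiskR_comp -?compmA.
by rewrite (eq_comp22 (bwNl _ _ _)).
Qed.

End Cyclicity.

Lemma evw_tensr A W V :
  evw A (W ⊗ V) • (ldual A ◁ a A W V) • a (ldual A) (A ⊗ W) V = evw A W ▷ V.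
Proof.
rewrite !evwE -?compmA pentV2 (eq_comp22 (esym (aR _ _ _))) (eq_comp21 (lu_tens _ _)).
by rewrite -!whiskR_comp.
Qed.

Lemma cotw_coev A W : cotw A W =
  a (ldual A) A W • ((c A (ldual A) • (theta A ▷ ldual A) • coev A) ▷ W)
    • luV W.
Proof.
rewrite cotwE bwE cowE -?compmA (eq_comp22 (esym (aR _ _ _))) aVaK.
by rewrite !whiskR_comp -?compmA.
Qed.

Lemma cotw_tensr A W V :
  (ldual A ◁ aV A W V) • cotw A (W ⊗ V) =
  a (ldual A) (A ⊗ W) V • (cotw A W ▷ V).
Proof.
rewrite !cotw_coev -luV_tens (eq_comp22 (esym (aR _ _ _))) (eq_comp31 (pentV _ _ _ _)).
by rewrite -?compmA -!whiskR_comp.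
Qed.

Lemma ptr_tensr A W W' V (psi : hom (A ⊗ W) (A ⊗ W')) :
  ptr (a A W' V • (psi ▷ V) • aV A W V) = ptr psi ▷ V.
Proof.
rewrite !ptrE !whiskL_comp -?compmA cotw_tensr (eq_comp22 (esym (aM _ _ _))).
by rewrite (eq_comp31 (evw_tensr _ _ _)) -!whiskR_comp.
Qed.

(** This links [ptr] to the trace in the definition of the S-matrix; taking [W = I] transfers
    identities from one to the other. *)
Lemma ptr_whiskR A W (f : hom A A) :
  ptr (f ▷ W) = lu W • (ribbon_trace c theta f ▷ W) • luV W.
Proof.
rewrite ptrE cotw_coev evwE -?compmA (eq_comp22 (esym (aM _ _ _))) aVaK.
do 2!rewrite (eq_comp21 (esym (whiskR_comp _ _ _))).
congr (_ • (_ ▷ _) • _).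
rewrite /ribbon_trace -?compmA thetaN whiskR_comp -?compmA.
by rewrite (eq_comp22 (cN f _)).
Qed.

Lemma ptr_linear A W W' (s : K) (f g : hom (A ⊗ W) (A ⊗ W')) :
  ptr (s *: f + g) = s *: ptr f + ptr g.
Proof. by rewrite !ptrE whisk_lin_r comp_linear_l comp_linear_r. Qed.

Lemma ptrZ A W W' (s : K) (f : hom (A ⊗ W) (A ⊗ W')) :
  ptr (s *: f) = s *: ptr f.
Proof.
have e0 : ptr (0 : hom (A ⊗ W) (A ⊗ W')) = 0.
  have := ptr_linear 1 (0 : hom (A ⊗ W) (A ⊗ W')) 0.
  by rewrite !scale1r addr0 => /esym/eqP; rewrite -subr_eq0 addrK => /eqP.
by rewrite -[s *: f]addr0 ptr_linear e0 addr0.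
Qed.

Lemma whiskR_unit_inj X Y (f g : hom X Y) : f ▷ I = g ▷ I -> f = g.
Proof.
move=> e; apply: (cancel_split_epi (ruruV X)).
by rewrite -!ruN e.
Qed.

Lemma compm_scalel X Y Z (s : K) (g : hom Y Z) (f : hom X Y) :
  (s *: g) • f = s *: (g • f).
Proof.
have := comp_linear_l s g 0 f.
have := comp_linear_l (- 1) g g f; rewrite !scaleN1r !addNr => ->.
by rewrite !addr0.
Qed.

Lemma compm_scaler X Y Z (s : K) (g : hom Y Z) (f : hom X Y) :
  g • (s *: f) = s *: (g • f).
Proof.
have := comp_linear_r s g f 0.
have := comp_linear_r (- 1) g f f; rewrite !scaleN1r !addNr => ->.
by rewrite !addr0.
Qed.

Lemma whiskR_scale X Y W (s : K) (f : hom X Y) : (s *: f) ▷ W = s *: (f ▷ W).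
Proof.
have := whisk_lin_l W s f 0.
have := whisk_lin_l W (- 1) f f; rewrite !scaleN1r !addNr => ->.
by rewrite !addr0.
Qed.

Lemma ribbon_trace_cyclic A B (g : hom B A) (h : hom A B) :
  ribbon_trace c theta (g • h) = ribbon_trace c theta (h • g).
Proof.
apply: whiskR_unit_inj; apply: (cancel_split_mono (luVlu I)).
apply: (cancel_split_epi (luVlu I)).
by rewrite -?compmA -!ptr_whiskR !whiskR_comp ptr_cyclic.
Qed.

(** The endomorphism of [Z] given by a loop coloured [A] encircling it. On a simple [Z] it is a
    scalar, the value at [A] of a character of the Grothendieck ring. *)
Definition phi A Z : hom Z Z := ptr (c Z A • c A Z).

(** The hexagons split the loop [A ⊗ B] into two concentric loops around [Z]; the inner loop [A] is
    replaced by the scalar [t]. *)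
Lemma phi_tens A B Z (t : K) :
  phi A Z = t *: idm Z -> phi (A ⊗ B) Z = t *: phi B Z.
Proof.
move=> e; have [_ _ hex1 hex2] := cP.
have cl : c (A ⊗ B) Z =
    a Z A B • (c A Z ▷ B) • aV A Z B • (A ◁ c B Z) • a A B Z.
  apply: (cancel_split_mono (aaV Z A B)); rewrite aVaK.
  apply: (cancel_split_epi (aVa A B Z)).
  by rewrite hex2 -?compmA aaV compm1.
have cr : c Z (A ⊗ B) =
    aV A B Z • (A ◁ c Z B) • a A Z B • (c Z A ▷ B) • aV Z A B.
  apply: (cancel_split_mono (aVa A B Z)); rewrite aaVK.
  apply: (cancel_split_epi (aaV Z A B)).
  by rewrite hex1 -?compmA aVa compm1.
rewrite /phi cl cr -?compmA aVaK.
transitivity (ptr (aV A B Z • ((A ◁ c Z B) •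
   (a A Z B • ((c Z A • c A Z) ▷ B) • aV A Z B) • (A ◁ c B Z)) • a A B Z)).
  by rewrite whiskR_comp -?compmA.
rewrite ptr_tens ptr_natural ptr_tensr -/(phi A Z) e whiskR_scale whiskL_id.
by rewrite compm_scalel comp1m compm_scaler ptrZ.
Qed.

(** The trace over [A ⊗ Z] is computed by closing the strand [A] first, which leaves [phi A Z] under
    the trace over [Z]. *)
Lemma ribbon_trace_braid A Z (t : K) :
  phi A Z = t *: idm Z ->
  ribbon_trace c theta (c Z A • c A Z) = t *: ribbon_trace c theta (idm Z).
Proof.
move=> e.
apply: whiskR_unit_inj; apply: (cancel_split_mono (luVlu I)).
apply: (cancel_split_epi (luVlu I)).
rewrite -?compmA -ptr_whiskR.
rewrite whiskR_scale compm_scalel compm_scaler -ptr_whiskR.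
rewrite -ptrZ -whiskR_scale -e -[in RHS]ptr_tensr -ptr_tens.
by rewrite -?compmA aVaK aVa compm1.
Qed.

End Ribbon.
End Braided.
End Calculus.

(** * Semisimplicity and multiplicities *)

Section VectDirectSum.
Set Implicit Arguments.
Unset Strict Implicit.
Import GRing.Theory.
Local Open Scope ring_scope.
Variables (K : fieldType) (V : vectType K) (n : nat) (U : 'I_n -> vectType K).
Variables (i : forall m, {linear U m -> V}) (p : forall m, {linear V -> U m}).
Hypothesis pi1 : forall m u, p m (i m u) = u.
Hypothesis pi0 : forall m m' u, m != m' -> p m' (i m u) = 0.
Hypothesis ip : forall v, \sum_m i m (p m v) = v.

Lemma dim_direct_sum : \dim {: V} = \sum_m \dim {: U m}.
Proof.
have inj_i m : \dim (limg (linfun (i m))) = \dim {: U m}.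
  apply: limg_dim_eq; apply/eqP; rewrite -subv0 capfv.
  apply/subvP => u; rewrite memv_ker lfunE /= => /eqP iu.
  by rewrite memv0 -(pi1 u) iu linear0.
have full : fullv = (\sum_m limg (linfun (i m)))%VS.
  apply/esym/vspaceP => v; rewrite memvf -(ip v); apply: memv_sumr => m _.
  by rewrite -[i m _](lfunE (i m)); apply: memv_img; apply: memvf.
have dir : directv (\sum_m limg (linfun (i m))).
  apply/directv_sum_independent => us Us us0 m _.
  have [u Hu] : exists u : forall k, U k, forall k, us k = i k (u k).
    apply: (@choice_dep _ _ (fun k u => us k = i k u)) => k.
    by have /memv_imgP [u _ ->] := Us k isT; exists u; rewrite lfunE.
  have : p m (\sum_k us k) = u m.
    rewrite linear_sum (bigD1 m) //= big1 ?addr0 ?Hu ?pi1 // => k km.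
    by rewrite Hu pi0.
  by rewrite us0 linear0 Hu => <-; rewrite linear0.
by rewrite full (directvP dir) /=; apply: eq_bigr => m _; rewrite inj_i.
Qed.

End VectDirectSum.

Section ClosedFieldEigen.
Set Implicit Arguments.
Unset Strict Implicit.
Import VectorInternalTheory.
Import GRing.Theory.
Local Open Scope ring_scope.

Lemma closed_eigenvector (K : closedFieldType) (V : vectType K)
    (f : {linear V -> V}) :
  (exists v : V, v != 0) -> exists a (v : V), v != 0 /\ f v = a *: v.
Proof.
case=> v0 v00.
have n_gt0 : (0 < dim V)%N.
  rewrite -dimvf lt0n dimv_eq0; apply: contra v00 => /eqP e.
  by rewrite -memv0 -e memvf.
pose M := lin1_mx (v2r \o f \o r2v).
have /closed_rootP [a ra] : size (char_poly M) != 1%N.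
  by rewrite size_char_poly; case: (dim V) n_gt0.
move: ra; rewrite -eigenvalue_root_char => /eigenvalueP [w wM w0].
exists a, (r2v w); split.
  by apply: contra w0 => /eqP r0; rewrite -[w]r2vK r0 linear0.
have -> : a *: r2v w = r2v (a *: w) :> V by rewrite linearZ_LR.
by rewrite -wM mul_rV_lin1 /= v2rK.
Qed.

End ClosedFieldEigen.

Section Semisimple.
Set Implicit Arguments.
Unset Strict Implicit.
Import GRing.Theory Defs.
Local Open Scope ring_scope.
Local Open Scope cat_scope.
Local Notation "f • g" := (comp f g) (at level 41, right associativity).
Variables (K : closedFieldType) (C : fusionCategory K).
Implicit Types A B W X Y Z : C.
Local Notation "A ◁ f" := (idm A ⊗₁ f) (at level 39, left associativity).
Local Notation "f ▷ W" := (f ⊗₁ idm W) (at level 39, left associativity).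
Local Notation I := (unit_obj (tensor C)).

Definition postc X Y Z (g : hom Y Z) (f : hom X Y) : hom X Z := g • f.
Definition prec X Y Z (f : hom X Y) (g : hom Y Z) : hom X Z := g • f.

Fact postc_linear X Y Z (g : hom Y Z) : linear (@postc X Y Z g).
Proof. by move=> s f f'; exact: comp_linear_r. Qed.
Fact prec_linear X Y Z (f : hom X Y) : linear (@prec X Y Z f).
Proof. by move=> s g g'; exact: comp_linear_l. Qed.
HB.instance Definition _ X Y Z (g : hom Y Z) :=
  GRing.isLinear.Build K _ _ _ (@postc X Y Z g) (@postc_linear X Y Z g).
HB.instance Definition _ X Y Z (f : hom X Y) :=
  GRing.isLinear.Build K _ _ _ (@prec X Y Z f) (@prec_linear X Y Z f).

Definition whiskr A X Y (f : hom X Y) : hom (X ⊗ A) (Y ⊗ A) := f ▷ A.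
Fact whiskr_linear A X Y : linear (@whiskr A X Y).
Proof. by move=> s f f'; exact: whisk_lin_l. Qed.
HB.instance Definition _ A X Y :=
  GRing.isLinear.Build K _ _ _ (@whiskr A X Y) (@whiskr_linear A X Y).

Lemma comp0m X Y Z (f : hom X Y) : (0 : hom Y Z) • f = 0.
Proof. exact: linear0 (prec f). Qed.
Lemma compm0 X Y Z (g : hom Y Z) : g • (0 : hom X Y) = 0.
Proof. exact: linear0 (postc g). Qed.
Lemma compmB X Y Z (g : hom Y Z) (f f' : hom X Y) :
  g • (f - f') = g • f - g • f'.
Proof. exact: (linearB (postc g)). Qed.
Lemma compBm X Y Z (g g' : hom Y Z) (f : hom X Y) :
  (g - g') • f = g • f - g' • f.
Proof. exact: (linearB (prec f)). Qed.
Lemma comp_suml X Y Z n (g : 'I_n -> hom Y Z) (f : hom X Y) :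
  (\sum_m g m) • f = \sum_m (g m • f).
Proof. exact: (linear_sum (prec f)). Qed.
Lemma comp_sumr X Y Z n (g : hom Y Z) (f : 'I_n -> hom X Y) :
  g • (\sum_m f m) = \sum_m (g • f m).
Proof. exact: (linear_sum (postc g)). Qed.

Lemma idm_neq0 X : is_simple X -> idm X != 0.
Proof.
case=> Xn0 _; apply/eqP => e; apply: Xn0 => Y; split=> f.
  by rewrite -[f]compm1 e compm0.
by rewrite -[f]comp1m e comp0m.
Qed.

(** Schur's lemma: the kernel of [f] is a subobject of [X], so it is zero, making [f] a monomorphism
    into a simple object, or all of [X]. *)
Lemma simple_hom X Y (f : hom X Y) :
  is_simple X -> is_simple Y -> f = 0 \/ is_iso f.
Proof.
move=> [Xn0 Xs] [Yn0 Ys]; have [_ kerC _ _ _] := fusion_abelian C.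
have [Z [k [fk kP]]] := kerC _ _ f.
have kmono : is_mono k.
  move=> T g h e; have [|m [_ mU]] := kP T (k • h); first by rewrite compmA fk comp0m.
  by rewrite -(mU g e) -(mU h erefl).
case: (Xs _ k kmono) => [Z0|[k' [_ kk']]].
  have fmono : is_mono f.
    move=> T g h e; apply/eqP; rewrite -subr_eq0; apply/eqP.
    have [|m [<- _]] := kP T (g - h); first by rewrite compmB e subrr.
    by have [_ z] := Z0 T; rewrite (z m) compm0.
  by case: (Ys _ f fmono) => [/Xn0|]; [|right].
by left; rewrite -[f]compm1 -kk' compmA fk comp0m.
Qed.

(** Composition with [f] on the nonzero space End(X) has an eigenvalue [s]. Since [f - s] kills an
    eigenvector it is not invertible, so it vanishes by Schur. *)
Lemma simple_end X (f : hom X X) : is_simple X -> exists s, f = s *: idm X.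
Proof.
move=> Xs; have X0 := idm_neq0 Xs.
have [|s [v [v0 fv]]] := @closed_eigenvector K (hom X X) (postc f).
  by exists (idm X).
exists s; apply/eqP; rewrite -subr_eq0; apply/eqP.
case: (simple_hom (f - s *: idm X) Xs Xs) => // -[g [gf _]].
case/eqP: v0; rewrite -[v]comp1m -gf -compmA compBm compm_scalel comp1m.
have -> : f • v = s *: v := fv.
by rewrite subrr compm0.
Qed.

Lemma dim_end_simple X : is_simple X -> \dim {: hom X X} = 1%N.
Proof.
move=> Xs; have <- : <[idm X]>%VS = fullv.
  apply/vspaceP => f; rewrite memvf; have [s ->] := simple_end f Xs.
  by rewrite memvZ ?memv_line.
by rewrite dim_vline idm_neq0.
Qed.

Lemma hom_simples_neq i j (f : hom (simples C i) (simples C j)) :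
  i != j -> f = 0.
Proof.
move=> ij; case: (simple_hom f (simples_simple i) (simples_simple j)) => // fi.
by case/eqP: ij; apply: simples_inj; exists f.
Qed.

Lemma dim_hom_simples i j :
  \dim {: hom (simples C i) (simples C j)} = (i == j) :> nat.
Proof.
have [->|ij] := eqVneq; first exact/dim_end_simple/simples_simple.
apply/eqP; rewrite dimv_eq0; apply/eqP/vspaceP => f.
by rewrite (hom_simples_neq f ij) !mem0v.
Qed.

Lemma direct_sum_iso n (F G : 'I_n -> C) X :
  (forall m, isomorphic (F m) (G m)) -> is_direct_sum F X -> is_direct_sum G X.
Proof.
move=> FG [inj [proj [h1 h0 hs]]].
have [u uP] := choice_dep FG; have [v vP] := choice_dep uP.
exists (fun m => inj m • v m), (fun m => u m • proj m); split=> [m|m m' mm'|].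
- rewrite -?compmA (compmA (proj m)) h1 comp1m; exact: (vP m).2.
- by rewrite -?compmA (compmA (proj m')) h0 // comp0m compm0.
- rewrite -hs; apply: eq_bigr => m _.
  by rewrite -?compmA (compmA (v m)) (vP m).1 comp1m.
Qed.

Lemma simples_decomposition X :
  exists n (sg : 'I_n -> 'I_(rank C)), is_direct_sum (simples C \o sg) X.
Proof.
have [n [F [Fs FX]]] := @fusion_semisimple _ C X.
have [sg sgP] := choice_dep (fun m => simples_surj (Fs m)).
by exists n, sg; apply: direct_sum_iso FX.
Qed.

Lemma dim_hom_sumr n (F : 'I_n -> C) X Z : is_direct_sum F X ->
  \dim {: hom Z X} = (\sum_m \dim {: hom Z (F m)})%N.
Proof.
move=> [inj [proj [h1 h0 hs]]].
apply: (@dim_direct_sum _ _ _ _ (fun m => @postc Z _ _ (inj m))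
  (fun m => @postc Z _ _ (proj m))) => [m u|m m' u mm'|v] /=; rewrite /postc.
- by rewrite compmA h1 comp1m.
- by rewrite compmA h0 // comp0m.
- rewrite -[RHS]comp1m -hs comp_suml; apply: eq_bigr => m _.
  by rewrite compmA.
Qed.

Lemma dim_hom_suml n (F : 'I_n -> C) X Z : is_direct_sum F X ->
  \dim {: hom X Z} = (\sum_m \dim {: hom (F m) Z})%N.
Proof.
move=> [inj [proj [h1 h0 hs]]].
apply: (@dim_direct_sum _ _ _ _ (fun m => @prec _ _ Z (proj m))
  (fun m => @prec _ _ Z (inj m))) => [m u|m m' u mm'|v] /=; rewrite /prec.
- by rewrite -compmA h1 compm1.
- by rewrite -compmA h0 1?eq_sym // compm0.
- rewrite -[RHS]compm1 -hs comp_sumr; apply: eq_bigr => m _.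
  by rewrite compmA.
Qed.

Definition mult (X : C) (l : 'I_(rank C)) : nat := \dim {: hom (simples C l) X}.

Section Additive.
Variables (X : C) (n : nat) (sg : 'I_n -> 'I_(rank C)).
Hypothesis dX : is_direct_sum (simples C \o sg) X.

Lemma mult_count l : mult X l = (\sum_m (sg m == l))%N.
Proof.
rewrite /mult (dim_hom_sumr _ dX); apply: eq_bigr => m _.
by rewrite dim_hom_simples eq_sym.
Qed.

Lemma sum_mult (V : nmodType) (F : 'I_(rank C) -> V) :
  \sum_m F (sg m) = \sum_l F l *+ mult X l.
Proof.
under [RHS]eq_bigr => l _ do rewrite mult_count -sumrMnr.
rewrite exchange_big; apply: eq_bigr => m _ /=.
rewrite (bigD1 (sg m)) //= eqxx mulr1n big1 ?addr0 // => l ln.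
by rewrite eq_sym (negPf ln).
Qed.

End Additive.

Lemma dim_hom_sym X l : \dim {: hom X (simples C l)} = mult X l.
Proof.
have [n [sg dX]] := simples_decomposition X.
rewrite (mult_count dX) (dim_hom_suml _ dX); apply: eq_bigr => m _.
exact: dim_hom_simples.
Qed.

Lemma dim_hom_iso_eq X Y X' Y' (f : hom X Y -> hom X' Y')
    (g : hom X' Y' -> hom X Y) :
  linear f -> cancel f g -> cancel g f ->
  \dim {: hom X Y} = \dim {: hom X' Y'}.
Proof.
move=> fl fK gK.
pose fL := GRing.isLinear.Build K _ _ _ f fl.
pose f' : {linear hom X Y -> hom X' Y'} := HB.pack f fL.
have gl : linear g.
  by move=> s u v; apply: (can_inj fK); rewrite gK fl !gK.
pose gL := GRing.isLinear.Build K _ _ _ g gl.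
pose g' : {linear hom X' Y' -> hom X Y} := HB.pack g gL.
(* A linear bijection is a direct sum decomposition with a single summand. *)
rewrite (@dim_direct_sum _ _ 1 (fun=> hom X' Y') (fun=> g') (fun=> f')).
- by rewrite big_ord1.
- by move=> m u; exact: gK.
- by move=> m m' u; rewrite !ord1.
- by move=> v; rewrite big_ord1; exact: fK.
Qed.

Lemma dim_hom_adj A X Y :
  \dim {: hom (ldual A ⊗ X) Y} = \dim {: hom X (A ⊗ Y)}.
Proof.
apply: (@dim_hom_iso_eq _ _ _ _ (fun f => (A ◁ f) • cow A X)
  (fun g => evw A Y • (ldual A ◁ g))) => [s f g|f|g].
- by rewrite whisk_lin_r comp_linear_l.
- by rewrite whiskL_comp (eq_comp22 (evwN _ _)) zigzag2 compm1.
- by rewrite whiskL_comp -compmA cowN (eq_comp21 (zigzag1 _ _)) comp1m.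
Qed.

(** Tensoring with the dual acts by the transposed fusion matrix. This later makes the characters
    orthogonal. *)
Lemma mult_dual i j k :
  mult (ldual (simples C i) ⊗ simples C k) j =
  mult (simples C i ⊗ simples C j) k.
Proof. by rewrite -dim_hom_sym dim_hom_adj. Qed.

Lemma mult_iso X Y l : isomorphic X Y -> mult X l = mult Y l.
Proof.
case=> f [g [gf fg]].
apply: (@dim_hom_iso_eq _ _ _ _ (postc f) (postc g)) => [|u|u].
- exact: postc_linear.
- by rewrite /postc compmA gf comp1m.
- by rewrite /postc compmA fg comp1m.
Qed.

Lemma isomorphic_of_mult X (l : 'I_(rank C)) : (forall k, mult X k = (k == l)) ->
  isomorphic X (simples C l).
Proof.
move=> mX; have [n [sg dX]] := simples_decomposition X.
have n1 : n = 1%N.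
  have := sum_mult dX (fun=> 1%N); rewrite sum1_card card_ord => ->.
  rewrite (bigD1 l) //= mX eqxx big1 ?addr0 // => k kl.
  by rewrite mX (negPf kl).
subst n; have sg0 : sg ord0 = l.
  by have := mX l; rewrite (mult_count dX) big_ord1 eqxx; case: eqP.
case: dX => inj [proj [h1 _]]; rewrite big_ord1 => hs.
by rewrite -sg0; exists (proj ord0), (inj ord0); split=> //; apply: h1.
Qed.

Lemma iso_sym X Y : isomorphic X Y -> isomorphic Y X.
Proof. by case=> f [g [gf fg]]; exists g, f. Qed.

Lemma iso_trans X Y Z : isomorphic X Y -> isomorphic Y Z -> isomorphic X Z.
Proof.
case=> f [g [gf fg]] [f' [g' [gf' fg']]]; exists (f' • f), (g • g'); split.
  by rewrite -!compmA (compmA g') gf' comp1m.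
by rewrite -!compmA (compmA f) fg comp1m.
Qed.

Lemma iso_tensr X Y B : isomorphic X Y -> isomorphic (B ⊗ X) (B ⊗ Y).
Proof.
case=> f [g [gf fg]]; exists (B ◁ f), (B ◁ g).
by rewrite -!whiskL_comp gf fg !whiskL_id.
Qed.

Lemma iso_runit X : isomorphic (X ⊗ I) X.
Proof.
exists (runit (tensor C) X), (runitV (tensor C) X); split.
  exact: ruVru.
exact: ruruV.
Qed.

End Semisimple.

(** * The characters of the Grothendieck ring *)

Section Modular.
Set Implicit Arguments.
Unset Strict Implicit.
Import GRing.Theory Defs.
Local Open Scope ring_scope.
Local Open Scope cat_scope.
Local Notation "f • g" := (comp f g) (at level 41, right associativity).
Variables (K : closedFieldType) (C : modularCategory K).
Implicit Types A B W X Y Z : C.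
Local Notation "A ◁ f" := (idm A ⊗₁ f) (at level 39, left associativity).
Local Notation "f ▷ W" := (f ⊗₁ idm W) (at level 39, left associativity).
Local Notation I := (unit_obj (tensor C)).
Local Notation c := (@braid K C).
Local Notation theta := (@twist K C).
Let cP : is_braiding c := @braidP K C.
Let tP : is_ribbon c theta := @twistP K C.
Local Notation ptr := (ptr c theta).
Local Notation phi := (phi c theta).
Local Notation simples := (simples C).

Lemma ptr0 A W W' : ptr (0 : hom (A ⊗ W) (A ⊗ W')) = 0.
Proof. by rewrite -[X in ptr X](scale0r 0) ptrZ scale0r. Qed.

Lemma ptrD A W W' (f g : hom (A ⊗ W) (A ⊗ W')) : ptr (f + g) = ptr f + ptr g.
Proof. by rewrite -[f]scale1r ptr_linear !scale1r. Qed.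

(** Cutting the loop with the resolution of [idm X], naturality of the double braiding moves the
    injections to the front, and cyclicity brings them around to cancel the projections. *)
Lemma phi_direct_sum n (F : 'I_n -> C) X Z : is_direct_sum F X ->
  phi X Z = \sum_m phi (F m) Z.
Proof.
case=> inj [proj [h1 h0 hs]].
have e : c Z X • c X Z =
    \sum_m (inj m ▷ Z) • ((c Z (F m) • c (F m) Z) • (proj m ▷ Z)).
  rewrite -[LHS]compm1 -whiskL_id -hs.
  have -> : (\sum_m inj m • proj m) ▷ Z = \sum_m ((inj m ▷ Z) • (proj m ▷ Z)).
    apply: etrans (linear_sum (@whiskr _ _ Z _ _) _ _ _) _.
    by apply: eq_bigr => m _; exact: whiskR_comp.
  rewrite comp_sumr; apply: eq_bigr => m _.
  rewrite -?compmA (eq_comp22 (cN cP (inj m) (idm Z))).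
  by rewrite (eq_comp22 (cN cP (idm Z) (inj m))).
rewrite /phi e (big_morph _ (@ptrD X Z Z) (@ptr0 X Z Z)).
apply: eq_bigr => m _; rewrite (ptr_cyclic cP tP) -?compmA -whiskR_comp h1.
by rewrite whiskL_id compm1.
Qed.

(** The ratio of [s_Aj] to the quantum dimension of the [j]-th simple object, as [S_chi] shows;
    defined as a Schur scalar it needs no division. *)
Definition chi A j : K :=
  sval (cid (simple_end (phi A (simples j)) (simples_simple j))).

Lemma chiP A j : phi A (simples j) = chi A j *: idm (simples j).
Proof. by rewrite /chi; case: cid. Qed.

Lemma scale_idm_inj j : injective (fun s : K => s *: idm (simples j)).
Proof.
move=> s t /eqP; rewrite -subr_eq0 -scalerBl scaler_eq0 subr_eq0.
by rewrite (negPf (idm_neq0 (simples_simple j))) orbF => /eqP.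
Qed.

Lemma chi_tens A B j : chi (A ⊗ B) j = chi A j * chi B j.
Proof.
apply: (@scale_idm_inj j); rewrite -chiP (phi_tens cP tP _ (chiP A j)).
by rewrite chiP scalerA.
Qed.

Lemma chi_mult A j : chi A j = \sum_l chi (simples l) j *+ mult A l.
Proof.
have [n [sg dA]] := simples_decomposition A.
rewrite -(sum_mult dA (fun l => chi (simples l) j)).
apply: (@scale_idm_inj j); rewrite -chiP (phi_direct_sum _ dA) scaler_suml.
by apply: eq_bigr => m _; rewrite chiP.
Qed.

Lemma chi_iso A B j : isomorphic A B -> chi A j = chi B j.
Proof.
by move=> AB; rewrite !chi_mult; apply: eq_bigr => l _; rewrite (mult_iso _ AB).
Qed.

Definition qdim j : K := unit_scalar (ribbon_trace c theta (idm (simples j))).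

Lemma S_chi i j : S_matrix c theta i j = chi (simples i) j * qdim j.
Proof.
rewrite mxE (ribbon_trace_braid cP tP (chiP _ _)) /unit_scalar.
by rewrite linearZ.
Qed.

Lemma S_sym i j : S_matrix c theta i j = S_matrix c theta j i.
Proof. by rewrite !mxE (ribbon_trace_cyclic cP tP). Qed.

Definition chi_mx : 'M[K]_(rank C) := \matrix_(i, j) chi (simples i) j.

Lemma S_chi_mx : S_matrix c theta = chi_mx *m diag_mx (\row_j qdim j).
Proof.
by apply/matrixP => i j; rewrite mul_mx_diag !mxE -S_chi mxE.
Qed.

Lemma chi_mx_unit : chi_mx \in unitmx.
Proof.
have := @S_nondegenerate K C.
by rewrite S_chi_mx unitmx_mul => /andP [].
Qed.

Lemma qdim_neq0 j : qdim j != 0.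
Proof.
have := @S_nondegenerate K C.
rewrite S_chi_mx unitmx_mul => /andP [_].
rewrite unitmxE det_diag unitfE => /prodf_neq0 /(_ j isT).
by rewrite mxE.
Qed.

Lemma unit_index : exists o, isomorphic I (simples o).
Proof. exact/simples_surj/unit_simple. Qed.

(** A column of the invertible matrix [chi_mx] has a nonzero entry, at [i] say, and multiplicativity
    applied to the isomorphism of [X_i ⊗ I] with [X_i] allows cancelling it. *)
Lemma chi_unit o j : isomorphic I (simples o) -> chi (simples o) j = 1.
Proof.
move=> Io.
have [i ij] : exists i, chi (simples i) j != 0.
  apply: contrapT => /forallNP n0.
  have z : chi_mx *m delta_mx j (0 : 'I_1) = 0.
    apply/matrixP => i k; rewrite mxE (bigD1 j) //= big1 => [|l lj].
      by rewrite !mxE; have /negP := n0 i; rewrite negbK => /eqP ->; rewrite mul0r addr0.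
    by rewrite !mxE (negPf lj) mulr0.
  have /matrixP /(_ j 0) : delta_mx j (0 : 'I_1) = 0 :> 'cV[K]_(rank C).
    by rewrite -[LHS](mulKmx chi_mx_unit) z mulmx0.
  by rewrite !mxE !eqxx => /eqP; rewrite oner_eq0.
apply: (mulfI ij); rewrite mulr1 -chi_tens; apply: chi_iso.
exact: iso_trans (iso_tensr _ (iso_sym Io)) (iso_runit _).
Qed.

(** By [mult_dual] the hypothesis says that the dual of [X_j] tensored with [X_j] is the unit; the
    braiding gives the other side, so [X_j] is invertible. *)
Lemma perfect_unit o j : is_perfect C -> isomorphic I (simples o) ->
  (forall l, mult (simples j ⊗ simples l) j = (l == o)) -> j = o.
Proof.
move=> perf Io mo.
have ldI : isomorphic (ldual (simples j) ⊗ simples j) I.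
  apply: iso_trans (iso_sym Io); apply: isomorphic_of_mult => l.
  by rewrite mult_dual mo.
have [ciso _ _ _] := cP.
apply: simples_inj; apply: iso_trans Io.
apply: perf; first exact: simples_simple.
exists (ldual (simples j)); split=> //.
exact: iso_trans (ex_intro _ _ (ciso _ _)) ldI.
Qed.

End Modular.

(** * Integrality and rationality *)

Section Integrality.
Set Implicit Arguments.
Unset Strict Implicit.
Import Order.TTheory GRing.Theory Num.Theory.
Local Open Scope ring_scope.

(** Rational root theorem: after clearing denominators, monicity shows that [denq q] divides a power
    of [numq q], to which it is coprime. *)
Lemma rat_root_monic_int (p : {poly int}) (q : rat) :
  p \is monic -> root (map_poly intr p) q -> exists z : int, q = z%:~R.
Proof.
move=> pm /rootP pq; exists (numq q).
have b0 : (denq q)%:~R != 0 :> rat by rewrite intr_eq0 denq_neq0.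
have [k sp] : exists k, size p = k.+1.
  by exists (size p).-1; rewrite prednK // size_poly_gt0 monic_neq0.
have lc : p`_k = 1 by move/monicP: pm; rewrite lead_coefE sp.
have qb : q * (denq q)%:~R = (numq q)%:~R by rewrite -{1}[q]divq_num_den divfK.
have e : \sum_(i < k.+1) p`_i * (numq q ^+ i * denq q ^+ (k - i)) = 0.
  apply: (intr_inj (R := rat)); rewrite rmorph_sum /=.
  transitivity ((map_poly intr p).[q] * (denq q)%:~R ^+ k); last by rewrite pq mul0r.
  rewrite horner_coef size_map_inj_poly ?sp //; last exact: intr_inj.
  rewrite mulr_suml; apply: eq_bigr => i _.
  rewrite !rmorphM !rmorphXn /= coef_map -qb exprMn -!mulrA -exprD subnKC //.
  by rewrite -ltnS.
move: e; rewrite big_ord_recr /= lc subnn expr0 mulr1 mul1r => /eqP.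
rewrite addrC addr_eq0 => /eqP e.
have : (denq q %| numq q ^+ k)%Z.
  rewrite e rpredN; apply: rpred_sum => i _.
  by rewrite dvdz_mull // dvdz_mull // dvdz_exp // subn_gt0.
rewrite -[_ ^+ k]mulr1 Gauss_dvdzr; last first.
  by rewrite coprimez_sym coprimezXl // coprimezE coprime_num_den.
rewrite dvdz1 => /eqP d1; have : denq q = 1 by rewrite -absz_denq d1.
by move=> d1'; rewrite -qb d1' mulr1.
Qed.

Variable F : numClosedFieldType.
Local Notation algint := (integralOver (intr : int -> F)).

Lemma integral_rat (q : rat) : algint (ratr q) -> exists z : int, q = z%:~R.
Proof.
case=> p pm pq; apply: (rat_root_monic_int pm).
rewrite -(fmorph_root (@ratr F)) -map_poly_comp.
by rewrite (eq_map_poly (g := intr)) // => z /=; rewrite ratr_int.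
Qed.

Lemma integral_eigen n (M : 'M[int]_n) (v : 'cV[F]_n) (l : F) :
  v != 0 -> map_mx intr M *m v = l *: v -> algint l.
Proof.
move=> v0 Mv; exists (char_poly M^T); first exact: char_poly_monic.
rewrite map_char_poly -eigenvalue_root_char; apply/eigenvalueP.
exists v^T; last by rewrite trmx_eq0.
by rewrite -map_trmx -trmx_mul Mv linearZ.
Qed.

Lemma integral_prod (I : finType) (P : pred I) (E : I -> F) :
  (forall i, algint (E i)) -> algint (\prod_(i | P i) E i).
Proof.
move=> Ei; apply: (big_ind algint) => // [|x y]; first exact: integral1.
exact: integral_mul.
Qed.

Lemma integral_exp (x : F) n : algint x -> algint (x ^+ n).
Proof.
move=> xi; elim: n => [|n IH]; first exact: integral1.
by rewrite exprS; apply: integral_mul.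
Qed.

Lemma horner_mx_eigen n (A : 'M[F]_n.+1) (v : 'cV[F]_n.+1) l (p : {poly F}) :
  A *m v = l *: v -> horner_mx A p *m v = p.[l] *: v.
Proof.
move=> Av; elim/poly_ind: p => [|p c IH]; first by rewrite rmorph0 mul0mx horner0 scale0r.
rewrite rmorphD rmorphM /= horner_mx_X horner_mx_C mulmxDl -mulmxA Av -scalemxAr IH.
by rewrite !hornerE mul_scalar_mx scalerA -scalerDl mulrC.
Qed.

Lemma exp_mx_eigen n (A : 'M[F]_n.+1) (v : 'cV[F]_n.+1) l e :
  A *m v = l *: v -> A ^+ e *m v = l ^+ e *: v.
Proof.
by move=> Av; have := horner_mx_eigen 'X^e Av; rewrite rmorphXn /= horner_mx_X hornerXn.
Qed.

Lemma mulmx_diag_colP m n (A : 'M[F]_m) (P : 'M[F]_(m, n)) (x : 'I_n -> F) :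
  (forall j, A *m col j P = x j *: col j P) <-> A *m P = P *m diag_mx (\row_j x j).
Proof.
split=> [e|e j].
  rewrite mul_mx_diag; apply/matrixP => i j; have /matrixP /(_ i 0) := e j.
  rewrite !mxE mulrC => <-.
  by apply: eq_bigr => k _; rewrite !mxE.
apply/matrixP => i k; have /matrixP /(_ i j) := e.
rewrite mul_mx_diag !mxE mulrC => <-.
by apply: eq_bigr => l _; rewrite !mxE.
Qed.

(* Lagrange interpolation in C turns Y into a rational matrix whose eigenvalue
   on the j-th common eigenvector is [y j ^+ e j]. *)
Lemma rational_eigen_prod n (P : 'M[F]_n) (C Y : 'M[rat]_n)
    (x : 'I_n -> rat) (y : 'I_n -> F) (e : 'I_n -> nat) :
  P \in unitmx ->
  (forall j, map_mx ratr C *m col j P = ratr (x j) *: col j P) ->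
  (forall j, map_mx ratr Y *m col j P = y j *: col j P) ->
  (forall i j, x i = x j -> e i = e j) ->
  exists q : rat, \prod_j y j ^+ e j = ratr q.
Proof.
case: n => [|n] in P C Y x y e *.
  by exists 1; rewrite big_ord0 rmorph1.
move=> Pu HC HY xe.
pose L j : {poly rat} := \prod_(i | x i != x j) ((x j - x i)^-1 *: ('X - (x i)%:P)).
have LE j k : (L j).[x k] = (x k == x j)%:R.
  rewrite /L horner_prod; have [->|kj] := eqVneq (x k) (x j).
    by apply: big1 => i ij; rewrite !hornerE mulVf // subr_eq0 eq_sym.
  by rewrite (bigD1 k) //= !hornerE subrr mulr0 mul0r.
(* Indices with equal [x] share the same Lagrange polynomial, so the sum over all [j] counts each of
   them repeatedly; [w] corrects for this. *)
pose w j : rat := (#|[pred i | x i == x j]|%:R)^-1.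
pose Z := \sum_j w j *: (horner_mx C (L j) * Y ^+ e j).
have HZ : map_mx ratr Z *m P = P *m diag_mx (\row_j y j ^+ e j).
  apply/mulmx_diag_colP => k; rewrite /Z raddf_sum mulmx_suml.
  have term j : map_mx ratr (w j *: (horner_mx C (L j) * Y ^+ e j)) *m col k P
      = (ratr (w k) * y k ^+ e k *+ (x j == x k)) *: col k P.
    rewrite map_mxZ map_mxM -scalemxAl -mulmxA rmorphXn /=.
    rewrite (exp_mx_eigen _ (HY k)) -scalemxAr map_horner_mx.
    rewrite (horner_mx_eigen _ (HC k)) horner_map /= LE ratr_nat eq_sym.
    have [ejk|] := eqVneq (x j) (x k).
      by rewrite !scalerA mulr1 mulr1n (xe _ _ ejk) /w ejk.
    by rewrite mulr0n !scale0r !scaler0.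
  under eq_bigr => j _ do rewrite term.
  rewrite -scaler_suml sumrMnr.
  have -> : (\sum_j (x j == x k) = #|[pred i | x i == x k]|)%N.
    by rewrite -sum1_card [RHS]big_mkcond.
  rewrite -mulrnAl -[_ *+ _]mulr_natr.
  rewrite /w fmorphV rmorph_nat mulVf ?mul1r // pnatr_eq0 -lt0n.
  by apply/card_gt0P; exists k; rewrite inE.
(* [Z] is rational and conjugate over [F] to the diagonal matrix of the [y j ^+ e j]. *)
exists (\det Z); have := congr1 determinant HZ.
rewrite !det_mulmx det_diag mulrC det_map_mx => /mulfI ->.
  by apply: eq_bigr => j _; rewrite mxE.
by move: Pu; rewrite unitmxE unitfE.
Qed.

End Integrality.

(** * Character tables of modular fusion rings *)

Section CharacterTable.
Set Implicit Arguments.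
Unset Strict Implicit.
Import Order.TTheory GRing.Theory Num.Theory.
Local Open Scope ring_scope.
(** In the application [N] holds the fusion coefficients, [T] is [chi_mx], [T'] gives the characters
    of the dual objects and [d] the quantum dimensions, so [T i j * d j] is an entry of the
    symmetric S-matrix. *)
Variables (F : numClosedFieldType) (r : nat) (o : 'I_r).
Variables (N : 'I_r -> 'I_r -> 'I_r -> nat) (T : 'M[F]_r).
Variables (T' : 'I_r -> 'I_r -> F) (d : 'I_r -> F).
Hypothesis T_unit : T \in unitmx.
Hypothesis T_o : forall j, T o j = 1.
Hypothesis NT : forall i k j, \sum_l (N i k l)%:R * T l j = T i j * T k j.
Hypothesis NT' : forall i k j, \sum_l (N i l k)%:R * T l j = T' i j * T k j.
Hypothesis d_neq0 : forall j, d j != 0.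
Hypothesis T_sym : forall i j, T i j * d j = T j i * d i.

Lemma T_col_inj (a : 'I_r -> F) : (forall i, \sum_j T i j * a j = 0) ->
  forall j, a j = 0.
Proof.
move=> Ta0 j; have : T *m (\col_j a j) = 0.
  by apply/matrixP => i k; rewrite !mxE -[RHS](Ta0 i); apply: eq_bigr => l _; rewrite mxE.
move/(congr1 (mulmx (invmx T))); rewrite mulKmx // mulmx0.
by move/matrixP/(_ j 0); rewrite !mxE.
Qed.

Lemma T_cols_neq a b : a != b -> exists i, T i a != T i b.
Proof.
move=> ab; apply/existsP; apply: contraNT ab; rewrite negb_exists => /forallP e.
have := @T_col_inj (fun j => (j == a)%:R - (j == b)%:R).
have H i : \sum_j T i j * ((j == a)%:R - (j == b)%:R) = 0.
  under eq_bigr => j _ do rewrite mulrBr.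
  rewrite big_split /= sumrN (bigD1 a) //= eqxx mulr1 big1 ?addr0 => [|j /negPf->].
    rewrite (bigD1 b) //= eqxx mulr1 big1 ?addr0 => [|j /negPf->].
      by have := e i; rewrite negbK => /eqP ->; rewrite subrr.
    by rewrite mulr0.
  by rewrite mulr0.
move/(_ H a); rewrite eqxx; case: (a == b) => //.
by move/eqP; rewrite subr0 oner_eq0.
Qed.

Definition dot a b := \sum_i (T i a)^* * T i b.
(* The formal codegree of the j-th character. *)
Definition cod j := dot j j.

Lemma codE j : cod j = \sum_i `|T i j| ^+ 2.
Proof. by apply: eq_bigr => i _; rewrite normCK mulrC. Qed.

Lemma cod_gt0 j : 0 < cod j.
Proof.
rewrite codE (bigD1 o) //= T_o normr1 expr1n ltr_wpDr ?ltr01 //.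
by apply: sumr_ge0 => i _; rewrite exprn_ge0.
Qed.

(** The [i]-th fusion matrix is moved from one side of the hermitian product to the other: it acts
    on column [b] by [T i b], and its transpose on column [a] by [T' i a]. *)
Lemma dot_fusion i a b : T i b * dot a b = (T' i a)^* * dot a b.
Proof.
rewrite /dot !mulr_sumr.
transitivity (\sum_k \sum_l (N i k l)%:R * (T k a)^* * T l b).
  apply: eq_bigr => k _; rewrite mulrCA -NT mulr_sumr.
  by apply: eq_bigr => l _; rewrite mulrA (mulrC _ (_%:R)).
rewrite exchange_big; apply: eq_bigr => l _ /=; rewrite -mulr_suml mulrA.
congr (_ * _); rewrite -rmorphM -NT' rmorph_sum; apply: eq_bigr => k _ /=.
by rewrite rmorphM /= conjC_nat.
Qed.

Lemma T'_conj i j : T' i j = (T i j)^*.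
Proof.
have /mulIf e := lt0r_neq0 (cod_gt0 j).
by rewrite (e _ _ (dot_fusion i j j)) conjCK.
Qed.

Lemma dot_orth a b : dot a b = cod a *+ (a == b).
Proof.
have [->|ab] := eqVneq a b; first by rewrite mulr1n.
have [i Ti] := T_cols_neq ab; apply/eqP; rewrite mulr0n.
apply: contraNT Ti => n0; have := dot_fusion i a b.
by rewrite T'_conj conjCK => /(mulIf n0) ->.
Qed.

Definition Tstar : 'M[F]_r := \matrix_(j, i) (T i j)^*.

Lemma Tstar_T : Tstar *m T = diag_mx (\row_j cod j).
Proof.
apply/matrixP => a b; rewrite !mxE -dot_orth.
by apply: eq_bigr => i _; rewrite mxE.
Qed.

Lemma T_inv : T *m (diag_mx (\row_j (cod j)^-1) *m Tstar) = 1%:M.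
Proof.
apply: mulmx1C; rewrite -mulmxA Tstar_T mulmx_diag -diag_const_mx.
congr diag_mx; apply/matrixP => i j; rewrite !mxE mulVf //.
exact/lt0r_neq0/cod_gt0.
Qed.

Lemma T_dual_orth i k : \sum_j T i j * (T k j)^* / cod j = (i == k)%:R.
Proof.
have /matrixP /(_ i k) := T_inv; rewrite !mxE => <-.
by apply: eq_bigr => j _; rewrite mul_diag_mx !mxE mulrA mulrAC.
Qed.

(** Symmetry turns orthogonality of rows into a second formula for products of columns. Compared
    with [T_inv], it shows that the diagonal matrix of the [(g j)^-1] commutes with [T]; the row
    [o], whose entries are all 1, then makes [g] constant. *)
Lemma cod_d j : cod j * `|d j| ^+ 2 = cod o * `|d o| ^+ 2.
Proof.
pose g j := cod j * `|d j| ^+ 2.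
have nd0 i : `|d i| ^+ 2 != 0 by rewrite expf_neq0 ?normr_eq0.
have c0 i : cod i != 0 by exact/lt0r_neq0/cod_gt0.
have g0 i : g i != 0 by rewrite mulf_neq0.
have row : Tstar *m diag_mx (\row_j (g j)^-1) *m T = diag_mx (\row_j (`|d j| ^+ 2)^-1).
  apply/matrixP => i k; rewrite mul_mx_diag !mxE.
  transitivity ((\sum_j T k j * (T i j)^* / cod j) / ((d i)^* * d k)).
    rewrite mulr_suml; apply: eq_bigr => l _; rewrite !mxE /g normCK.
    have -> : T l i = T i l * d l / d i by rewrite T_sym mulfK.
    have -> : T l k = T k l * d l / d k by rewrite T_sym mulfK.
    rewrite !rmorphM fmorphV /=.
    by field; rewrite !d_neq0 c0 !fmorph_eq0 !d_neq0.
  rewrite T_dual_orth eq_sym; have [->|] := eqVneq i k.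
    by rewrite !mulr1n mul1r normCK mulrC.
  by rewrite mul0r mulr0n.
have e : T *m diag_mx (\row_j (g j)^-1) = diag_mx (\row_j (g j)^-1) *m T.
  rewrite -[RHS]mul1mx -T_inv -!mulmxA; congr (_ *m _).
  rewrite (mulmxA Tstar) row mulmx_diag.
  by congr diag_mx; apply/matrixP => i k; rewrite !mxE -invfM.
have /matrixP /(_ o j) := e; rewrite mul_mx_diag mul_diag_mx !mxE T_o mul1r mulr1.
by move/invr_inj.
Qed.

Lemma parseval (a : 'I_r -> F) :
  \sum_i `|\sum_j T i j * a j| ^+ 2 = \sum_j `|a j| ^+ 2 * cod j.
Proof.
transitivity (\sum_i \sum_j \sum_l ((T i j)^* * T i l) * ((a j)^* * a l)).
  apply: eq_bigr => i _; rewrite normCK mulrC rmorph_sum mulr_suml.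
  apply: eq_bigr => j _; rewrite mulr_sumr; apply: eq_bigr => l _.
  by rewrite rmorphM /=; ring.
rewrite exchange_big; apply: eq_bigr => j _ /=.
rewrite exchange_big /= (bigD1 j) //= -mulr_suml -/(dot j j) big1 => [|l lj].
  by rewrite addr0 normCK -/(cod j); ring.
by rewrite -mulr_suml -/(dot j l) dot_orth eq_sym (negPf lj) mulr0n mul0r.
Qed.

Lemma T_expand (w : 'I_r -> F) : exists a : 'I_r -> F,
  forall i, w i = \sum_j T i j * a j.
Proof.
exists (fun j => (invmx T *m \col_i w i) j 0) => i.
have /matrixP /(_ i 0) : T *m (invmx T *m \col_i w i) = \col_i w i by rewrite mulKVmx.
by rewrite !mxE => <-.
Qed.

(* If [c_k] is maximal, then [w = |T _ k|] satisfies [N_i w >= |T i k| w], and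
   comparing norms over all [i] forces equality; so [w] is a common eigenvector,
   hence one of the columns up to a scalar. *)
Lemma perron_character : exists k, forall i, 0 <= T i k.
Proof.
have cod_real j : cod j \is Num.real by rewrite ger0_real // ltW // cod_gt0.
pose k := [arg max_(i > o) cod i]%O.
have kmax j : cod j <= cod k.
  rewrite /k.
  case: (@real_arg_maxP _ _ o xpredT cod isT (fun i _ => cod_real i)) => i _ H.
  exact: (H j isT).
pose w i := `|T i k|.
have [a wa] := T_expand w.
have Nw i b : \sum_l (N i b l)%:R * w l = \sum_j T b j * (T i j * a j).
  under eq_bigr => l _ do rewrite wa mulr_sumr.
  rewrite exchange_big; apply: eq_bigr => j _ /=.
  rewrite mulrA (mulrC (T b j)) -NT mulr_suml.
  by apply: eq_bigr => l _; rewrite mulrA.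
have Nw_ge i b : `|T i k| * w b <= \sum_l (N i b l)%:R * w l.
  rewrite -normrM -NT; apply: le_trans (ler_norm_sum _ _ _) _.
  by apply: ler_sum => l _; rewrite normrM normr_nat.
have w_ge0 b : 0 <= w b by exact: normr_ge0.
have Nw_ge0 i b : 0 <= \sum_l (N i b l)%:R * w l.
  by apply: sumr_ge0 => l _; rewrite mulr_ge0.
have lower : cod k * cod k = \sum_i \sum_b (`|T i k| * w b) ^+ 2.
  rewrite {1}codE mulr_suml; apply: eq_bigr => i _.
  by rewrite codE mulr_sumr; apply: eq_bigr => b _; rewrite exprMn.
(* By Parseval for each [i], the left side is the sum of [|a j|^2 * cod j ^ 2]. Bounding one factor
   by [cod k] leaves the square norm of [w], which is [cod k]. *)
have upper : \sum_i \sum_b (\sum_l (N i b l)%:R * w l) ^+ 2 <= cod k * cod k.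
  have -> : \sum_i \sum_b (\sum_l (N i b l)%:R * w l) ^+ 2 =
      \sum_j cod j * (`|a j| ^+ 2 * cod j).
    transitivity (\sum_i \sum_j `|T i j * a j| ^+ 2 * cod j).
      apply: eq_bigr => i _; rewrite -parseval; apply: eq_bigr => b _.
      by rewrite -Nw ger0_norm.
    rewrite exchange_big; apply: eq_bigr => j _ /=.
    rewrite {2}codE mulr_suml; apply: eq_bigr => i _.
    by rewrite normrM exprMn -mulrA.
  have -> : cod k * cod k = \sum_j cod k * (`|a j| ^+ 2 * cod j).
    rewrite -mulr_sumr -parseval codE; congr (_ * _); apply: eq_bigr => i _.
    by rewrite -wa /w normr_id.
  apply: ler_sum => j _; apply: ler_wpM2r => //.
  by rewrite mulr_ge0 ?exprn_ge0 // ltW // cod_gt0.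
have eqNw i b : \sum_l (N i b l)%:R * w l = `|T i k| * w b.
  apply/eqP; rewrite -(@eqrXn2 _ 2) // ?mulr_ge0 // eq_sym.
  pose D i b := (\sum_l (N i b l)%:R * w l) ^+ 2 - (`|T i k| * w b) ^+ 2.
  have D_ge0 i' b' : 0 <= D i' b' by rewrite subr_ge0 ler_pXn2r // nnegrE ?mulr_ge0.
  have D0 : \sum_i \sum_b D i b = 0.
    apply/le_anti/andP; split; last by do 2!apply: sumr_ge0 => ? _.
    have -> : \sum_i \sum_b D i b =
        \sum_i \sum_b (\sum_l (N i b l)%:R * w l) ^+ 2 - cod k * cod k.
      by rewrite lower -sumrB; apply: eq_bigr => i' _; rewrite -sumrB.
    by rewrite subr_le0.
  have Di : \sum_b D i b = 0.
    apply: (psumr_eq0P _ D0) => // i' _; exact: sumr_ge0.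
  have Dib : D i b = 0 by apply: (psumr_eq0P _ Di).
  by rewrite -subr_eq0 -oppr_eq0 opprB -/(D i b) Dib.
have [j aj] : exists j, a j != 0.
  apply/existsP; apply: contraT; rewrite negb_exists => /forallP a0.
  have : w o = 0.
    by rewrite wa big1 // => j _; have /eqP -> := negPn (a0 j); rewrite mulr0.
  by rewrite /w T_o normr1 => /eqP; rewrite oner_eq0.
exists j => i.
suff -> : T i j = `|T i k| by exact: normr_ge0.
(* The eigenvector equation for [w] is expanded in the independent columns and read off at the
   coefficient [j]. *)
apply: (mulIf aj); apply/eqP; rewrite -subr_eq0; apply/eqP.
apply: (@T_col_inj (fun j => T i j * a j - `|T i k| * a j)) => b.
under eq_bigr => l _ do rewrite mulrBr.
rewrite big_split /= sumrN -Nw eqNw wa mulr_sumr; apply/eqP; rewrite subr_eq0.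
by apply/eqP/eq_bigr => l _; rewrite mulrCA.
Qed.

(** The vector of absolute values of column [j] satisfies [|T i j| w <= N_i w]. Pairing it with the
    nonnegative column [k], an eigenvector of the transpose of [N_i], gives the bound; the pairing
    is positive because of the index [o]. *)
Lemma perron_bound k : (forall i, 0 <= T i k) -> forall i j, `|T i j| <= T i k.
Proof.
move=> k0 i j; pose f l := T l k; pose w l := `|T l j|.
have fw_gt0 : 0 < \sum_l f l * w l.
  rewrite (bigD1 o) //= /f /w !T_o normr1 mulr1 ltr_wpDr ?ltr01 //.
  by apply: sumr_ge0 => l _; rewrite mulr_ge0.
rewrite -(ler_pM2r fw_gt0).
apply: (@le_trans _ _ (\sum_b f b * (\sum_l (N i b l)%:R * w l))).
  rewrite mulr_sumr; apply: ler_sum => b _; rewrite mulrCA; apply: ler_wpM2l; first exact: k0.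
  rewrite -normrM -NT; apply: le_trans (ler_norm_sum _ _ _) _.
  by apply: ler_sum => l _; rewrite normrM normr_nat.
rewrite le_eqVlt; apply/orP; left; apply/eqP.
under eq_bigr => b _ do rewrite mulr_sumr.
rewrite exchange_big mulr_sumr; apply: eq_bigr => l _ /=.
under eq_bigr => b _ do rewrite mulrCA mulrA.
rewrite -mulr_suml NT' T'_conj -/(f i) mulrA; congr (_ * _ * _).
by apply/CrealP; rewrite ger0_real //; exact: k0.
Qed.

(** * Perfect fusion rings with an integral Frobenius-Perron character *)

Section Perfect.
Variables (k : 'I_r) (m : 'I_r -> nat).
Hypothesis T_k : forall i, T i k = (m i)%:R.
Hypothesis N_o : forall i, N i o i = 1%N.
Hypothesis N_perfect : forall j, (forall l, N j l j = (l == o)) -> j = o.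

Let T_le i j : `|T i j| <= (m i)%:R.
Proof. by rewrite -T_k; apply: perron_bound => l; rewrite T_k ler0n. Qed.

Lemma FP_gt0 i : (0 < m i)%N.
Proof.
rewrite lt0n; apply/negP => /eqP mi0; have := T_dual_orth i i.
rewrite eqxx big1 => [/eqP|j _]; first by rewrite eq_sym oner_eq0.
have := T_le i j; rewrite mi0 normr_le0 => /eqP ->.
by rewrite !mul0r.
Qed.

Let mR_neq0 i : (m i)%:R != 0 :> F.
Proof. by rewrite pnatr_eq0 -lt0n FP_gt0. Qed.

(** The dual of [X_j] times [X_j] has dimension [m j ^ 2 = 1] and contains the unit, so there is no
    room for another constituent. *)
Lemma FP_eq1 j : m j = 1%N -> j = o.
Proof.
move=> mj; apply: N_perfect => l.
have mo : m o = 1%N by apply/eqP; rewrite -(eqr_nat F) -T_k T_o.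
have : (\sum_l N j l j * m l = 1)%N.
  apply/eqP; rewrite -(eqr_nat F) natr_sum; apply/eqP.
  under eq_bigr => i _ do rewrite natrM -T_k.
  by rewrite NT' T'_conj T_k mj rmorph1 mulr1.
rewrite (bigD1 o) //= N_o mo muln1 -[X in _ = X]addn0 => /addnI /eqP.
rewrite sum_nat_eq0 => /forallP H; have [->|lo] := eqVneq l o; first exact: N_o.
have := H l; rewrite lo muln_eq0 => /orP [/eqP -> //|].
by rewrite eqn0Ngt FP_gt0.
Qed.

Local Notation algint := (integralOver (intr : int -> F)).

Definition fusion_mx i : 'M[int]_r := \matrix_(a, b) (N i a b)%:Z.

Lemma fusion_mx_eigen i j :
  map_mx intr (fusion_mx i) *m col j T = T i j *: col j T.
Proof.
apply/matrixP => a b; rewrite !mxE -NT; apply: eq_bigr => l _.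
by rewrite !mxE.
Qed.

Lemma fusion_mx_tr_eigen i j :
  map_mx intr (fusion_mx i)^T *m col j T = (T i j)^* *: col j T.
Proof.
apply/matrixP => a b; rewrite !mxE -T'_conj -NT'; apply: eq_bigr => l _.
by rewrite !mxE.
Qed.

(** Integer matrices diagonalized by the columns of [T]: [norm_mx i] has the eigenvalues [|T i j|^2]
    and [casimir_mx] the formal codegrees. *)
Definition norm_mx i : 'M[int]_r := (fusion_mx i)^T *m fusion_mx i.
Definition casimir_mx : 'M[int]_r := \sum_i norm_mx i.

Lemma norm_mx_eigen i j :
  map_mx intr (norm_mx i) *m col j T = `|T i j| ^+ 2 *: col j T.
Proof.
rewrite map_mxM -mulmxA fusion_mx_eigen -scalemxAr fusion_mx_tr_eigen scalerA.
by rewrite normCK.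
Qed.

Lemma casimir_mx_eigen j :
  map_mx intr casimir_mx *m col j T = cod j *: col j T.
Proof.
rewrite /casimir_mx raddf_sum mulmx_suml codE scaler_suml.
by apply: eq_bigr => i _; rewrite norm_mx_eigen.
Qed.

Lemma T_col_neq0 j : col j T != 0.
Proof.
apply/eqP => /matrixP /(_ o 0); rewrite !mxE T_o => /eqP.
by rewrite oner_eq0.
Qed.

Lemma integral_cod j : algint (cod j).
Proof. exact: integral_eigen (T_col_neq0 j) (casimir_mx_eigen j). Qed.

Lemma integral_T i j : algint (T i j).
Proof. exact: integral_eigen (T_col_neq0 j) (fusion_mx_eigen i j). Qed.

Lemma integral_normT i j : algint (`|T i j| ^+ 2).
Proof. exact: integral_eigen (T_col_neq0 j) (norm_mx_eigen i j). Qed.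

Definition FPsum : nat := \sum_i m i ^ 2.

Lemma cod_k : cod k = FPsum%:R.
Proof.
rewrite codE natr_sum; apply: eq_bigr => i _.
by rewrite T_k normr_nat natrX.
Qed.

Lemma cod_norm j : cod j * (m j)%:R ^+ 2 = FPsum%:R * `|T k j| ^+ 2.
Proof.
have := T_sym j k; rewrite T_k => e.
have n0 : `|d k| ^+ 2 != 0 by rewrite expf_neq0 // normr_eq0.
have n1 : `|d j| ^+ 2 != 0 by rewrite expf_neq0 // normr_eq0.
have : `|(m j)%:R * d k| ^+ 2 = `|T k j * d j| ^+ 2 by rewrite e.
rewrite !normrM !exprMn normr_nat => e2.
apply: (mulIf n0); apply: (mulIf n1).
rewrite -cod_k; have := etrans (cod_d k) (esym (cod_d j)).
move: e2; move: (cod k) (cod j) (`|d k|) (`|d j|) (`|T k j|) => ck cj dk dj t.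
move=> e2 e3; transitivity (cj * dj ^+ 2 * ((m j)%:R ^+ 2 * dk ^+ 2)); first by ring.
by rewrite e2 -e3; ring.
Qed.

(** By [cod_norm] the subtracted term has eigenvalue [cod j * m j ^ 2], so the difference vanishes
    exactly where [m j = 1]. *)
Let shift_mx : 'M[int]_r := casimir_mx - FPsum%:R *: norm_mx k.

Let shift_mx_eigen j : map_mx intr shift_mx *m col j T =
  (cod j * (1 - (m j)%:R ^+ 2)) *: col j T.
Proof.
rewrite map_mxB map_mxZ mulmxBl casimir_mx_eigen -scalemxAl norm_mx_eigen.
by rewrite rmorph_nat scalerA -cod_norm -scalerBl mulrBr mulr1.
Qed.

(* For j != o the eigenvalue of shift_mx does not vanish, since perfectness
   gives m j != 1; so its kernel is a line, defined over the rationals. *)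
Lemma T_o_int i : exists z : int, T i o = z%:~R.
Proof.
pose Q : 'M[rat]_r := map_mx intr shift_mx.
have QF : map_mx ratr Q = map_mx intr shift_mx :> 'M[F]_r.
  by apply/matrixP => a b; rewrite !mxE ratr_int.
have mo : m o = 1%N by apply/eqP; rewrite -(eqr_nat F) -T_k T_o.
have detQ : \det Q^T = 0.
  apply: (fmorph_inj (@ratr F)); rewrite rmorph0 -det_map_mx; apply/eqP/det0P.
  exists (col o T)^T; first by rewrite trmx_eq0 T_col_neq0.
  by rewrite -map_trmx QF -trmx_mul shift_mx_eigen mo expr1n subrr mulr0 scale0r trmx0.
have /eqP/det0P [v v0 vQ] := detQ.
have Qv : Q *m v^T = 0 by apply: trmx_inj; rewrite trmx_mul trmxK vQ trmx0.
pose u i : F := ratr (v 0 i).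
have [a ua] := T_expand u.
(* The rational kernel vector [u] is expanded in the columns; each coefficient is killed by its
   eigenvalue, so only column [o] survives. *)
have Ma : forall j, cod j * (1 - (m j)%:R ^+ 2) * a j = 0.
  apply: T_col_inj => b.
  have /(congr1 (map_mx (@ratr F))) := Qv.
  rewrite map_mxM QF map_mx0 => /matrixP /(_ b 0); rewrite !mxE => e.
  rewrite -[RHS]e; under [RHS]eq_bigr => l _ do
    rewrite [X in _ * X]mxE [X in _ * ratr X]mxE -/(u l) ua mulr_sumr.
  rewrite exchange_big; apply: eq_bigr => j _ /=.
  under eq_bigr => l _ do rewrite mulrA.
  rewrite -mulr_suml mulrA; congr (_ * _).
  have /matrixP /(_ b 0) := shift_mx_eigen j; rewrite !mxE mulrC => <-.
  by apply: eq_bigr => l _; rewrite !mxE.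
have a0 j : j != o -> a j = 0.
  move=> jo; have /eqP := Ma j; rewrite mulf_eq0 => /orP [|/eqP //].
  rewrite mulf_eq0 (negPf (lt0r_neq0 (cod_gt0 j))) /= subr_eq0 eq_sym.
  rewrite sqrf_eq1 => /orP [|].
    by rewrite (eqr_nat F _ 1) => /eqP /FP_eq1 e; rewrite e eqxx in jo.
  by move=> /eqP e; have := ler0n F (m j); rewrite e oppr_ge0 ler10.
have uE l : u l = T l o * a o.
  by rewrite ua (bigD1 o) //= big1 ?addr0 // => j /a0 ->; rewrite mulr0.
have uo : u o = a o by rewrite uE T_o mul1r.
have ao : a o != 0.
  apply: contra v0 => /eqP e; apply/eqP/matrixP => x l; rewrite (ord1 x) mxE.
  apply: (fmorph_inj (@ratr F)); rewrite rmorph0; apply: etrans (uE l) _.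
  by rewrite e mulr0.
have Ti : T i o = ratr (v 0 i / v 0 o).
  have -> : ratr (v 0 i / v 0 o) = u i / u o by rewrite fmorph_div.
  by rewrite uo uE mulfK.
have [|z qz] := @integral_rat F (v 0 i / v 0 o).
  by rewrite -Ti; exact: integral_T.
by exists z; rewrite Ti qz ratr_int.
Qed.

(** As a nonzero integer, [T k o] has absolute value at least 1, so [cod o = FPsum * |T k o|^2] is
    at least [FPsum]. The bound [|T i o| <= m i] gives the converse, so equality holds termwise and
    [m k = |T k o| = 1]. *)
Lemma FP_index : k = o.
Proof.
have mo : m o = 1%N by apply/eqP; rewrite -(eqr_nat F) -T_k T_o.
have [z Tz] := T_o_int k.
have co := cod_norm o; rewrite mo expr1n mulr1 in co.
have z0 : z != 0.
  apply/eqP => z0; have := cod_gt0 o.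
  by rewrite co Tz z0 normr0 expr0n mulr0 ltxx.
have T1 : 1 <= `|T k o| ^+ 2.
  rewrite Tz expr_ge1 // -intr_norm ler1z.
  by rewrite -gtz0_ge1 normr_gt0.
have le_sum : cod o <= FPsum%:R.
  rewrite codE natr_sum; apply: ler_sum => i _.
  by rewrite natrX ler_pXn2r ?nnegrE ?ler0n // normr_ge0.
have eqo : cod o = FPsum%:R.
  by apply/le_anti; rewrite le_sum co ler_peMr ?ler0n.
have T2 : `|T k o| ^+ 2 = (m k)%:R ^+ 2.
  apply/eqP; rewrite eq_sym -subr_eq0; apply/eqP.
  have : \sum_i ((m i)%:R ^+ 2 - `|T i o| ^+ 2) = 0 :> F.
    rewrite sumrB -codE eqo natr_sum -sumrB big1 // => i _.
    by rewrite natrX subrr.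
  move/psumr_eq0P; apply=> // i _.
  by rewrite subr_ge0 ler_pXn2r ?nnegrE ?ler0n // normr_ge0.
have T3 : `|T k o| ^+ 2 = 1.
  have : FPsum%:R != 0 :> F by rewrite -cod_k; exact/lt0r_neq0/cod_gt0.
  by move/mulfI; apply; rewrite -co eqo mulr1.
apply: FP_eq1; apply/eqP; rewrite -(eqr_nat F).
by move: T2; rewrite T3 => /esym/eqP; rewrite sqrp_eq1 ?ler0n.
Qed.

Lemma T_FP i : T i o = (m i)%:R.
Proof. by rewrite -T_k FP_index. Qed.

Lemma cod_FP j : cod j * (m j)%:R ^+ 2 = FPsum%:R.
Proof. by rewrite cod_norm FP_index T_o normr1 expr1n mulr1. Qed.

Lemma T_sym_FP i j : T i j * (m j)%:R = T j i * (m i)%:R.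
Proof.
have dE l : d l = (m l)%:R * d o by rewrite -T_FP T_sym T_o mul1r.
apply: (mulIf (d_neq0 o)); rewrite -!mulrA -!dE; exact: T_sym.
Qed.

Lemma FPsum_gt0 : (0 < FPsum)%N.
Proof. by rewrite -(ltr_nat F) -cod_k cod_gt0. Qed.

Lemma cod_rat j : cod j = ratr (FPsum%:R / (m j)%:R ^+ 2).
Proof.
rewrite fmorph_div rmorphXn /= !ratr_nat -(cod_FP j) mulfK //.
by rewrite expf_neq0.
Qed.

(* The categorical form of Burnside's theorem on zeros of characters: by
   AM-GM with weights [m j ^ 2], a row of T without zeros would consist of
   numbers of absolute value 1. *)
Lemma T_zero i : i != o -> exists j, T i j = 0.
Proof.
move=> io; have [/existsP [j /eqP Tij]|/existsPn Tn0] := boolP [exists j, T i j == 0].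
  by exists j.
pose a j := `|T i j| ^+ 2.
have a_gt0 j : 0 < a j.
  by rewrite exprn_gt0 // normr_gt0; apply: contra (Tn0 j) => /eqP ->.
have suma : \sum_j a j * (m j)%:R ^+ 2 = FPsum%:R.
  have := T_dual_orth i i; rewrite eqxx => /(congr1 ( *%R FPsum%:R)).
  rewrite mulr1 mulr_sumr => <-; apply: eq_bigr => j _.
  rewrite /a normCK -(cod_FP j) [RHS]mulrC -!mulrA; congr (_ * (_ * _)).
  by rewrite mulKf //; exact/lt0r_neq0/cod_gt0.
(* The eigenvalues of [casimir_mx] are rational and determine [m j], hence the exponents [m j ^ 2],
   as the interpolation requires. *)
have [q Pq] : exists q : rat, \prod_j a j ^+ (m j ^ 2) = ratr q.
  apply: (@rational_eigen_prod F r T (map_mx intr casimir_mx)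
    (map_mx intr (norm_mx i)) (fun j => FPsum%:R / (m j)%:R ^+ 2)) => //.
  - move=> j; rewrite -cod_rat -casimir_mx_eigen; congr (_ *m _).
    by apply/matrixP => b c; rewrite !mxE ratr_int.
  - move=> j; rewrite -norm_mx_eigen; congr (_ *m _).
    by apply/matrixP => b c; rewrite !mxE ratr_int.
  - move=> j l; have F0 : FPsum%:R != 0 :> rat by rewrite pnatr_eq0 -lt0n FPsum_gt0.
    by move/(mulfI F0)/invr_inj/eqP; rewrite -!natrX eqr_nat => /eqP.
have [|z qz] := @integral_rat F q.
  rewrite -Pq; apply: integral_prod => j; apply: integral_exp.
  exact: integral_normT.
have P_ge1 : 1 <= \prod_j a j ^+ (m j ^ 2).
  have : 0 < \prod_j a j ^+ (m j ^ 2) by apply: prodr_gt0 => j _; exact: exprn_gt0.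
  by rewrite Pq qz ratr_int ltr0z gtz0_ge1 ler1z.
(* Each [j] is repeated [m j ^ 2] times, which turns the weighted inequality into the unweighted
   one. *)
pose I : finType := {j : 'I_r & 'I_(m j ^ 2)}.
pose E (x : I) := a (tag x).
have cI : #|I| = FPsum.
  rewrite card_tagged sumnE big_map big_enum; apply: eq_bigr => j _.
  by rewrite card_ord.
have sumE : \sum_x E x = FPsum%:R.
  rewrite -suma; transitivity (\sum_j \sum_(l : 'I_(m j ^ 2)) a j).
    by rewrite sig_big_dep.
  by apply: eq_bigr => j _; rewrite sumr_const card_ord -natrX mulr_natr.
have prodE : \prod_x E x = \prod_j a j ^+ (m j ^ 2).
  transitivity (\prod_j \prod_(l : 'I_(m j ^ 2)) a j).
    by rewrite sig_big_dep.
  by apply: eq_bigr => j _; rewrite prodr_const card_ord.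
have := @leif_AGM F I xpredT E (fun x _ => ltW (a_gt0 _)).
rewrite (eq_card (B := I)) // cI sumE divff; last first.
  by rewrite pnatr_eq0 -lt0n FPsum_gt0.
rewrite expr1n prodE => /ge_leif; rewrite P_ge1 => /esym /forallP Econst.
have aconst j l : a j = a l.
  have h1 : (0 < m j ^ 2)%N by rewrite expn_gt0 FP_gt0.
  have h2 : (0 < m l ^ 2)%N by rewrite expn_gt0 FP_gt0.
  have /forallP := Econst (Tagged (fun j => 'I_(m j ^ 2)) (Ordinal h1)).
  by move/(_ (Tagged (fun j => 'I_(m j ^ 2)) (Ordinal h2))) => /eqP.
have ao : a o = 1.
  have F0 : FPsum%:R != 0 :> F by rewrite pnatr_eq0 -lt0n FPsum_gt0.
  apply: (mulIf F0); rewrite mul1r -[in RHS]suma {1}/FPsum natr_sum mulr_sumr.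
  by apply: eq_bigr => j _; rewrite natrX (aconst o j).
case/eqP: io; apply: FP_eq1; apply/eqP; rewrite -(eqr_nat F).
by move/eqP: ao; rewrite /a T_FP normr_nat sqrp_eq1 ?ler0n.
Qed.

(** The quotient is the formal codegree [cod i], a rational algebraic integer. *)
Lemma FP_sq_dvd i : (m i ^ 2 %| FPsum)%N.
Proof.
have [|z cz] := @integral_rat F (FPsum%:R / (m i)%:R ^+ 2).
  by rewrite -cod_rat; exact: integral_cod.
have := cod_FP i; rewrite cod_rat cz ratr_int => e.
have : z * (m i ^ 2)%:Z = FPsum%:Z.
  by apply: (intr_inj (R := F)); rewrite rmorphM /= -!pmulrn natrX.
move/(congr1 absz); rewrite abszM !absz_nat => <-.
exact: dvdn_mull.
Qed.

(** [b i l] is the multiplicity of [X_l] in the product of the objects in [s] with [X_i]. *)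
Lemma fusion_product (s : seq 'I_r) : exists b : 'I_r -> 'I_r -> nat,
  forall i j, \sum_l (b i l)%:R * T l j = (\prod_(x <- s) T x j) * T i j.
Proof.
elim: s => [|x s [b bP]].
  exists (fun i l => (l == i) : nat) => i j.
  rewrite big_nil mul1r (bigD1 i) //= eqxx mul1r big1 ?addr0 // => l /negPf ->.
  by rewrite mul0r.
exists (fun i l => \sum_y N x i y * b y l)%N => i j.
transitivity (\sum_y (N x i y)%:R * (\sum_l (b y l)%:R * T l j)).
  under [RHS]eq_bigr => y _ do rewrite mulr_sumr.
  rewrite exchange_big; apply: eq_bigr => l _ /=.
  rewrite natr_sum mulr_suml; apply: eq_bigr => y _.
  by rewrite natrM mulrA.
transitivity (\sum_y (\prod_(t <- s) T t j) * ((N x i y)%:R * T y j)).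
  by apply: eq_bigr => y _; rewrite bP mulrCA.
by rewrite -mulr_sumr NT big_cons mulrCA mulrA.
Qed.

Lemma FPsum_dvd_prod : exists s : seq 'I_r, (FPsum %| \prod_(i <- s) m i)%N.
Proof.
have [z Tz] : exists z : 'I_r -> 'I_r, forall i, i != o -> T (z i) i = 0.
  (* [T_zero] provides a zero in row [i], which symmetry moves to column [i]. The implication makes
     the choice total; the value at [o] is arbitrary. *)
  have H i : exists j, (i != o) ==> (T j i == 0).
    have [->|io] := eqVneq i o; first by exists o.
    have [j Tij] := T_zero io; exists j; apply/eqP; apply: (mulIf (mR_neq0 i)).
    by rewrite T_sym_FP Tij !mul0r.
  by exists (fun i => xchoose (H i)) => i io; have /implyP/(_ io)/eqP := xchooseP (H i).
pose s := [seq z i | i <- enum 'I_r & i != o]; exists s.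
have [b bP] := fusion_product s.
have prod0 j : j != o -> \prod_(x <- s) T x j = 0.
  move=> jo; rewrite big_map big_filter big_enum_cond /= (bigD1 j) //=.
  by rewrite Tz // mul0r.
have : (b o o)%:R * FPsum%:R = (\prod_(i <- s) m i)%:R :> F.
  (* Orthogonality of rows against row [o], which is constantly 1, extracts the multiplicity of the
     unit. *)
  have boo : \sum_j (\sum_l (b o l)%:R * T l j) / cod j = (b o o)%:R.
    under eq_bigr => j _ do rewrite mulr_suml.
    rewrite exchange_big (bigD1 o) //= [X in _ + X]big1 => [|l lo].
      under eq_bigr => j _ do rewrite -mulrA.
      rewrite -mulr_sumr addr0; have := T_dual_orth o o; rewrite eqxx.
      under eq_bigr => j _ do rewrite T_o rmorph1 mulr1.
      by under [in X in _ -> X]eq_bigr => j _ do rewrite T_o; move=> ->; rewrite mulr1.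
    under eq_bigr => j _ do rewrite -mulrA.
    rewrite -mulr_sumr; have := T_dual_orth l o; rewrite (negPf lo).
    under eq_bigr => j _ do rewrite T_o rmorph1 mulr1.
    by move=> ->; rewrite mulr0.
  rewrite -boo (eq_bigr (fun j => (\prod_(x <- s) T x j) / cod j)) => [|j _].
    rewrite (bigD1 o) //= [X in _ + X]big1 => [|j jo]; last by rewrite prod0 // mul0r.
    rewrite addr0 -(cod_FP o) -T_FP T_o expr1n mulr1 divfK.
      by rewrite natr_prod; apply: eq_bigr => i _; rewrite T_FP.
    exact/lt0r_neq0/cod_gt0.
  by rewrite bP T_o mulr1.
rewrite -natrM => /eqP; rewrite eqr_nat => /eqP <-.
exact: dvdn_mull.
Qed.

End Perfect.

End CharacterTable.

(** * Frobenius-Perron dimensions *)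

Section FrobeniusPerronDimensions.
Set Implicit Arguments.
Unset Strict Implicit.
Import Order.TTheory GRing.Theory Num.Theory Defs.
Local Open Scope ring_scope.
Local Open Scope cat_scope.
Variables (R : realType) (C : modularCategory R[i]).
Local Notation F := (R[i] : numClosedFieldType).
Local Notation r := (rank C).
Local Notation T := (chi_mx C).

Definition fusion_coef (i j k : 'I_r) : nat := mult (simples C i ⊗ simples C j) k.
Local Notation N := fusion_coef.
Definition dual_chi i j : F := chi (ldual (simples C i)) j.

Lemma fusion_chi i k j : \sum_l (N i k l)%:R * T l j = T i j * T k j :> F.
Proof.
rewrite !mxE -chi_tens [RHS]chi_mult; apply: eq_bigr => l _.
by rewrite mxE mulr_natl.
Qed.

Lemma fusion_dual_chi i k j :
  \sum_l (N i l k)%:R * T l j = dual_chi i j * T k j :> F.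
Proof.
rewrite mxE /dual_chi -chi_tens [RHS]chi_mult; apply: eq_bigr => l _.
by rewrite mxE mult_dual mulr_natl.
Qed.

Lemma chi_sym i j : T i j * qdim j = T j i * qdim i :> F.
Proof. by rewrite !mxE -!S_chi S_sym. Qed.

Lemma fusion_coef_unit o i : isomorphic (one C) (simples C o) -> N i o i = 1%N.
Proof.
move=> Io; rewrite /N (@mult_iso _ _ _ (simples C i)); last first.
  exact: iso_trans (iso_tensr _ (iso_sym Io)) (iso_runit _).
by rewrite /mult dim_hom_simples eqxx.
Qed.

Section Perron.
Variables (o k : 'I_r).
Hypothesis Io : isomorphic (one C) (simples C o).
Hypothesis T_ge0 : forall i, 0 <= T i k.
Let T_o j : T o j = 1. Proof. by rewrite mxE; exact: chi_unit. Qed.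

(** Column [k] is an eigenvector of the fusion matrix, so [T i k] lies in the set under the
    supremum. Every other element of that set is some [T i j], bounded by [T i k]. *)
Lemma FPdim_chi i : (FPdim (simples C i))%:C%C = T i k.
Proof.
have [Mu Mo NM NM' M0] : [/\ T \in unitmx, forall j, T o j = 1,
  forall i k j, \sum_l (N i k l)%:R * T l j = T i j * T k j :> F,
  forall i k j, \sum_l (N i l k)%:R * T l j = dual_chi i j * T k j :> F
  & forall i, 0 <= T i k].
  split; [exact: chi_mx_unit|exact: T_o|exact: fusion_chi|exact: fusion_dual_chi|exact: T_ge0].
(* The character matrix is generalized so that [mxE] leaves its entries folded. *)
move: (chi_mx C) => M in Mu Mo NM NM' M0 *.
have Tr l : M l k = (complex.Re (M l k))%:C%C.
  by rewrite RRe_real // ger0_real.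
suff -> : FPdim (simples C i) = complex.Re (M i k) by rewrite -Tr.
have Tconj l : (M l k)^* = M l k by apply/CrealP; rewrite ger0_real.
have mem : [set x : R | 0 <= x /\ eigenvalue (fusion_matrix (simples C i)) x]%classic
    (complex.Re (M i k)).
  split; first by have := M0 i; rewrite Tr lecR.
  apply/eigenvalueP; exists (\row_a complex.Re (M a k)).
    apply/matrixP => x b; rewrite !mxE; apply: (@complexI R).
    rewrite rmorphM rmorph_sum /= -!Tr -{1}Tconj.
    rewrite -(T'_conj Mo NM NM').
    rewrite -NM'; apply: eq_bigr => a _.
    by rewrite !mxE rmorphM /= -Tr rmorph_nat mulrC.
  apply/eqP => /matrixP /(_ 0 o); rewrite !mxE Mo => /eqP.
  by rewrite oner_eq0.
have ub : ubound [set x : R | 0 <= x /\ eigenvalue (fusion_matrix (simples C i)) x]%classic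
    (complex.Re (M i k)).
  move=> x [x0 /eigenvalueP [v vA v0]].
  (* Pairing an eigenvector for [x] with column [j] forces [x = M i j] unless the pairing is zero;
     as [M] is invertible, some pairing is not. *)
  pose u j : F := \sum_a (v 0 a)%:C%C * M a j.
  have uE j : x%:C%C * u j = M i j * u j.
    rewrite /u !mulr_sumr.
    transitivity (\sum_b (\sum_a (v 0 a * (N i a b)%:R)%:C%C) * M b j).
      apply: eq_bigr => b _; rewrite mulrA -rmorphM -rmorph_sum; congr (_%:C%C * _).
      have /matrixP /(_ 0 b) := vA; rewrite !mxE => <-.
      by apply: eq_bigr => a _; rewrite !mxE.
    under eq_bigr => b _ do rewrite mulr_suml.
    rewrite exchange_big; apply: eq_bigr => a _ /=.
    rewrite mulrCA -NM mulr_sumr; apply: eq_bigr => b _.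
    by rewrite rmorphM /= rmorph_nat mulrA.
  have [j uj] : exists j, u j != 0.
    apply/existsP; apply: contraNT v0 => /existsPn u0; apply/eqP.
    have z : map_mx (real_complex R) v *m M = 0.
      apply/matrixP => y j; rewrite !mxE; have /negPn/eqP uj := u0 j.
      apply: etrans uj; by apply: eq_bigr => a _; rewrite mxE (ord1 y).
    have : map_mx (real_complex R) v = 0.
      by rewrite -[LHS](mulmxK Mu) z mul0mx.
    move=> /matrixP e; apply/matrixP => y a; have := e y a; rewrite !mxE.
    by apply: complexI.
  have xT : x%:C%C = M i j by apply: (mulIf uj).
  have := perron_bound Mo NM NM' M0 i j.
  by rewrite -xT Tr normc_def /= expr0n addr0 sqrtr_sqr lecR ger0_norm.
apply/le_anti/andP; split; first by apply: ge_sup => //; exists (complex.Re (M i k)).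
by apply: ub_le_sup => //; exists (complex.Re (M i k)).
Qed.

End Perron.

Lemma int_divides_nat p n : int_divides p (n%:R : R) <-> (p %| n)%N.
Proof.
split=> [[z e]|/dvdnP [q ->]]; last by exists q; rewrite -PoszM -pmulrn.
have := e; rewrite pmulrn => /intr_inj /(congr1 absz).
by rewrite abszM !absz_nat => ->; exact: dvdn_mull.
Qed.

Lemma FPdim_arithmetic : is_perfect C -> is_integral C ->
  exists m : 'I_r -> nat, [/\ forall i, FPdim (simples C i) = (m i)%:R,
    FPdim_cat C = (\sum_i m i ^ 2)%:R,
    forall i, (m i ^ 2 %| \sum_i m i ^ 2)%N
  & exists s : seq 'I_r, (\sum_i m i ^ 2 %| \prod_(i <- s) m i)%N].
Proof.
move=> perf integral_C; have [o Io] := unit_index C.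
have To j : T o j = 1 by rewrite mxE; exact: chi_unit.
have [k T0] := perron_character (chi_mx_unit C) To fusion_chi fusion_dual_chi.
have FPE := FPdim_chi Io T0.
have [m mE] : exists m : 'I_r -> nat, forall i, FPdim (simples C i) = (m i)%:R.
  apply: (@choice_dep _ (fun=> nat) (fun i n => FPdim (simples C i) = n%:R)) => i.
  have /intrP [z ez] := integral_C _ (simples_simple i).
  have : 0 <= FPdim (simples C i) by have := T0 i; rewrite -FPE lecR.
  rewrite ez ler0z; case: z {ez} => // n _; by exists n.
have Tm i : T i k = (m i)%:R :> F by rewrite -FPE mE rmorph_nat.
have No i := fusion_coef_unit i Io.
have Np j : (forall l, N j l j = (l == o)) -> j = o by exact: perfect_unit.
exists m; split=> //.
- by rewrite /FPdim_cat natr_sum; apply: eq_bigr => i _; rewrite mE natrX.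
- exact: (FP_sq_dvd (chi_mx_unit C) To fusion_chi fusion_dual_chi
    (@qdim_neq0 _ C) chi_sym Tm No Np).
- exact: (FPsum_dvd_prod (chi_mx_unit C) To fusion_chi fusion_dual_chi
    (@qdim_neq0 _ C) chi_sym Tm No Np).
Qed.

End FrobeniusPerronDimensions.

(** * Prime divisors of the global dimension *)

Local Open Scope classical_set_scope.
Theorem mainTheorem14 (R : realType) (C : modularCategory R[i])
    (hperfect : is_perfect C) (hintegral : is_integral C) :
  [/\ prime_divisors (FPdim_cat C) =
        \bigcup_(i : 'I_(rank C)) prime_divisors (FPdim (simples C i)),
      forall p : nat, prime p -> int_divides p (FPdim_cat C) ->
        exists X : C, is_simple X /\ int_divides p (FPdim X)
    & forall p : nat, prime p -> int_divides p (FPdim_cat C) ->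
        int_divides (p ^ 2) (FPdim_cat C)].
Proof.
have [m [mE catE sq_dvd [s dvd_s]]] := FPdim_arithmetic hperfect hintegral.
have cauchy p : prime p -> int_divides p (FPdim_cat C) ->
    exists i, p %| m i.
  rewrite catE => pp /int_divides_nat pn.
  exact: prime_dvd_prod_seq pp (dvdn_trans pn dvd_s).
split.
- rewrite eqEsubset; split=> p.
    move=> [pp pC]; have [i pi] := cauchy p pp pC.
    by exists i => //; split=> //; rewrite mE; apply/int_divides_nat.
  move=> [i _ [pp]]; rewrite mE => /int_divides_nat pi; split=> //.
  rewrite catE; apply/int_divides_nat; apply: dvdn_trans (sq_dvd i).
  exact: dvdn_trans pi (dvdn_exp _ _).
- move=> p pp pC; have [i pi] := cauchy p pp pC.
  exists (simples C i); split; first exact: simples_simple.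
  by rewrite mE; apply/int_divides_nat.
- move=> p pp pC; have [i pi] := cauchy p pp pC.
  rewrite catE; apply/int_divides_nat; apply: dvdn_trans (sq_dvd i).
  exact: dvdn_exp2r.
Qed.
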